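(* Let $\ell$ be a nonzero complex number. Then the vertex algebra $V_{\widehat{H}_4}(\ell,0)$ is a vertex operator algebra of central charge $4$ with conformal vector $$\omega=\frac{1}{\ell}\big(a(-1)b(-1)\mathbf{1}+c(-1)d(-1)\mathbf{1}\big)-\frac{1}{2\ell}c(-2)\mathbf{1}-\frac{1}{2\ell^2}c(-1)c(-1)\mathbf{1}.$$ The $\mathbb{Z}$-grading on $V_{\widehat{H}_4}(\ell,0)$ is given by $L(0)$-eigenvalues, where $Y(\omega,x)=\sum_{n\in\mathbb{Z}}L(n)x^{-n-2}$. Moreover, $H_4=V_{\widehat{H}_4}(\ell,0)_{(1)}$ (via $h\mapsto h(-1)\mathbf{1}$), which generates $V_{\widehat{H}_4}(\ell,0)$ as a vertex algebra, and $$[h(n),L(m)]=n\,h(m+n)\qquad\text{for } h\in H_4,\ m,n\in\mathbb{Z}.$$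
   Context: Nappi-Witten algebra: $H_4=\mathbb{C}a\oplus\mathbb{C}b\oplus\mathbb{C}c\oplus\mathbb{C}d$ with $[a,b]=c$, $[d,a]=a$, $[d,b]=-b$, $[c,d]=[c,a]=[c,b]=0$, and symmetric invariant form $(a,b)=(c,d)=1$, other pairings of basis vectors $0$. Its affinization is $\widehat{H}_4=H_4\otimes\mathbb{C}[t,t^{-1}]\oplus\mathbb{C}\mathbf{k}$, $[h_1\otimes t^m,h_2\otimes t^n]=[h_1,h_2]\otimes t^{m+n}+m(h_1,h_2)\delta_{m+n,0}\mathbf{k}$, $\mathbf{k}$ central. For $h\in H_4$, $h(n)$ denotes the action of $h\otimes t^n$ and $h(x)=\sum_{n\in\mathbb{Z}}h(n)x^{-n-1}$. $V_{\widehat{H}_4}(\ell,0)=U(\widehat{H}_4)\otimes_{U(H_4\otimes\mathbb{C}[t]\oplus\mathbb{C}\mathbf{k})}\mathbb{C}\mathbf{1}$, where $H_4\otimes\mathbb{C}[t]$ acts on $\mathbf{1}$ as $0$ and $\mathbf{k}$ as $\ell$. It has the (known) unique vertex algebra structure $(V_{\widehat{H}_4}(\ell,0),Y,\mathbf{1})$ with vacuum $\mathbf{1}$ and $Y(h(-1)\mathbf{1},x)=h(x)$ for $h\in H_4$. It is graded, $V_{\widehat{H}_4}(\ell,0)=\coprod_{n\ge0}V_{\widehat{H}_4}(\ell,0)_{(n)}$, where $V_{\widehat{H}_4}(\ell,0)_{(n)}$ is spanned by $h^{(1)}(-m_1)\cdots h^{(r)}(-m_r)\mathbf{1}$ with $r\ge0$,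 $h^{(i)}\in H_4$, $m_i\ge1$, $m_1+\cdots+m_r=n$. *)

(* Defs.v *)
From HB Require Import structures.
From mathcomp Require Import all_boot all_order all_algebra.
From mathcomp Require Import generic_quotient ring_quotient finmap ring.
From mathcomp Require Import boolp classical_sets reals complex.
From mathcomp.multinomials Require Import monalg.

Set Implicit Arguments.
Unset Strict Implicit.
Unset Printing Implicit Defensive.
Import Order.TTheory GRing.Theory Num.Theory.
Local Open Scope classical_set_scope.
Local Open Scope ring_scope.
Local Open Scope quotient_scope.

Section ModuleQuotient.
Variables (K : pzRingType) (M : lmodType K) (I : submodClosed M).

Definition mquot_pred : {pred M} := I.

Lemma mquot_pred_zmod_closed : zmod_closed mquot_pred.
Proof.
split=> [|x y Ix Iy]; first exact: (rpred0 I).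
by rewrite /mquot_pred rpredD // -scaleN1r rpredZ.
Qed.

HB.instance Definition _ := GRing.isZmodClosed.Build M mquot_pred
  mquot_pred_zmod_closed.

Definition mquot : Type := Quotient.quot mquot_pred.
HB.instance Definition _ := Choice.on mquot.

End ModuleQuotient.

HB.lock Definition mquot_pi (K : pzRingType) (M : lmodType K)
    (I : submodClosed M) (x : M) : mquot I :=
  \pi_(Quotient.quot (mquot_pred I)) x.

HB.lock Definition mquot_repr (K : pzRingType) (M : lmodType K)
    (I : submodClosed M) (v : mquot I) : M :=
  repr (v : Quotient.quot (mquot_pred I)).

Section ModuleQuotientTheory.
Variables (K : pzRingType) (M : lmodType K) (I : submodClosed M).
Local Notation mquot := (mquot I).
Local Notation mquot_pred := (mquot_pred I).
Local Notation mquot_pi := (mquot_pi I).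
Local Notation mquot_repr := (@mquot_repr K M I).

Lemma mquot_reprK : cancel mquot_repr mquot_pi.
Proof. by move=> v; rewrite mquot_pi.unlock mquot_repr.unlock reprK. Qed.

Lemma mquot_eqP x y : mquot_pi x = mquot_pi y <-> x - y \in I.
Proof.
rewrite mquot_pi.unlock.
change (\pi_(Quotient.quot mquot_pred) x = \pi y <-> x - y \in mquot_pred).
by rewrite Quotient.idealrBE; split=> [/eqP|/eqP].
Qed.

End ModuleQuotientTheory.

(* These operations, and those on [uea] and [ind_mod], are locked: unification
   would otherwise unfold them down to finite maps. *)
HB.lock Definition mquot_zero (K : pzRingType) (M : lmodType K)
    (I : submodClosed M) : mquot I :=
  mquot_pi I 0.

HB.lock Definition mquot_opp (K : pzRingType) (M : lmodType K)
    (I : submodClosed M) (u : mquot I) : mquot I :=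
  mquot_pi I (- mquot_repr u).

HB.lock Definition mquot_add (K : pzRingType) (M : lmodType K)
    (I : submodClosed M) (u v : mquot I) : mquot I :=
  mquot_pi I (mquot_repr u + mquot_repr v).

HB.lock Definition mquot_scale (K : pzRingType) (M : lmodType K)
    (I : submodClosed M) (c : K) (u : mquot I) : mquot I :=
  mquot_pi I (c *: mquot_repr u).

Section ModuleQuotientLmodule.
Variables (K : pzRingType) (M : lmodType K) (I : submodClosed M).
Local Notation mquot := (mquot I).
Local Notation mquot_pi := (mquot_pi I).
Local Notation mquot_repr := (@mquot_repr K M I).
Local Notation mquot_zero := (mquot_zero I).
Local Notation mquot_opp := (@mquot_opp K M I).
Local Notation mquot_add := (@mquot_add K M I).
Local Notation mquot_scale := (@mquot_scale K M I).

Let repr_pi x : x - mquot_repr (mquot_pi x) \in I.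
Proof. by apply/mquot_eqP; rewrite mquot_reprK. Qed.

Lemma mquot_piZ c x : mquot_pi (c *: x) = mquot_scale c (mquot_pi x).
Proof.
rewrite mquot_scale.unlock; apply/mquot_eqP.
by rewrite -scalerBr rpredZ ?repr_pi.
Qed.

Lemma mquot_piN x : mquot_pi (- x) = mquot_opp (mquot_pi x).
Proof.
rewrite mquot_opp.unlock; apply/mquot_eqP.
by rewrite -opprD -[- _]scaleN1r rpredZ ?repr_pi.
Qed.

Lemma mquot_piD x y : mquot_pi (x + y) = mquot_add (mquot_pi x) (mquot_pi y).
Proof.
rewrite mquot_add.unlock; apply/mquot_eqP.
by rewrite opprD addrACA rpredD ?repr_pi.
Qed.

Lemma mquot_addA : associative mquot_add.
Proof.
move=> u v w; rewrite -(mquot_reprK u) -(mquot_reprK v) -(mquot_reprK w).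
by rewrite -!mquot_piD addrA.
Qed.

Lemma mquot_addC : commutative mquot_add.
Proof.
move=> u v; rewrite -(mquot_reprK u) -(mquot_reprK v).
by rewrite -!mquot_piD addrC.
Qed.

Lemma mquot_add0 : left_id mquot_zero mquot_add.
Proof.
move=> u; rewrite -(mquot_reprK u) mquot_zero.unlock.
by rewrite -!mquot_piD add0r.
Qed.

Lemma mquot_addN : left_inverse mquot_zero mquot_opp mquot_add.
Proof.
move=> u; rewrite -(mquot_reprK u) mquot_zero.unlock.
by rewrite -!mquot_piN -!mquot_piD addNr.
Qed.

HB.instance Definition _ := GRing.isZmodule.Build mquot
  mquot_addA mquot_addC mquot_add0 mquot_addN.

Lemma mquot_pi_morphD : {morph mquot_pi : x y / x + y}.
Proof. exact: mquot_piD. Qed.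

Lemma mquot_scaleA a b v :
  mquot_scale a (mquot_scale b v) = mquot_scale (a * b) v.
Proof. by rewrite -(mquot_reprK v) -!mquot_piZ scalerA. Qed.

Lemma mquot_scale1 : left_id 1 mquot_scale.
Proof. by move=> v; rewrite -(mquot_reprK v) -!mquot_piZ scale1r. Qed.

Lemma mquot_scaleDr : right_distributive mquot_scale +%R.
Proof.
move=> a u v; rewrite -(mquot_reprK u) -(mquot_reprK v).
by rewrite -mquot_pi_morphD -!mquot_piZ scalerDr mquot_pi_morphD.
Qed.

Lemma mquot_scaleDl v : {morph mquot_scale^~ v : a b / a + b}.
Proof.
move=> a b; rewrite -(mquot_reprK v).
by rewrite -!mquot_piZ scalerDl mquot_pi_morphD.
Qed.

HB.instance Definition _ := GRing.Zmodule_isLmodule.Build K mquot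
  mquot_scaleA mquot_scale1 mquot_scaleDr mquot_scaleDl.

Lemma mquot_pi_is_linear : linear mquot_pi.
Proof. by move=> c x y; rewrite mquot_pi_morphD mquot_piZ. Qed.

HB.instance Definition _ :=
  GRing.isLinear.Build K M mquot *:%R mquot_pi mquot_pi_is_linear.

End ModuleQuotientLmodule.

Section Ideals.
Variables (K : pzRingType) (A : lalgType K) (S : set A).

Inductive in_lideal : A -> Prop :=
| lideal_gen x of S x : in_lideal x
| lideal0 : in_lideal 0
| lidealD x y of in_lideal x & in_lideal y : in_lideal (x + y)
| lidealMl a x of in_lideal x : in_lideal (a * x).

Inductive in_ideal : A -> Prop :=
| ideal_gen x of S x : in_ideal x
| ideal0 : in_ideal 0
| idealD x y of in_ideal x & in_ideal y : in_ideal (x + y)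
| idealMl a x of in_ideal x : in_ideal (a * x)
| idealMr a x of in_ideal x : in_ideal (x * a).

Definition lideal : {pred A} := fun x => `[< in_lideal x >].
Definition ideal : {pred A} := fun x => `[< in_ideal x >].

Lemma lideal_submod_closed : submod_closed lideal.
Proof.
split=> [|c x y /asboolP Ix /asboolP Iy]; apply/asboolP; first exact: lideal0.
by apply: lidealD => //; rewrite -[x]mul1r scalerAl; exact: lidealMl.
Qed.

Lemma ideal_submod_closed : submod_closed ideal.
Proof.
split=> [|c x y /asboolP Ix /asboolP Iy]; apply/asboolP; first exact: ideal0.
by apply: idealD => //; rewrite -[x]mul1r scalerAl; exact: idealMl.
Qed.

HB.instance Definition _ := GRing.isSubmodClosed.Build K A lideal
  lideal_submod_closed.
HB.instance Definition _ := GRing.isSubmodClosed.Build K A ideal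
  ideal_submod_closed.

End Ideals.

Section FreeAlgebra.
Variables (K : fieldType) (I : choiceType).

Lemma fmalg_scaleAr (c : K) (x y : {malg K[{fmonom I}]}) :
  c *: (x * y) = x * (c *: y).
Proof.
apply/malgP => k; rewrite mcoeffZ.
apply: etrans (congr1 ( *%R c) (mcoeffMl x y k)) _.
apply: etrans _ (esym (mcoeffMlw k (fsubset_refl _) (msuppZ_le c y))).
rewrite mulr_sumr.
apply: eq_bigr => i _; rewrite mulr_sumr; apply: eq_bigr => j _.
by rewrite mcoeffZ mulrnAr mulrCA.
Qed.

HB.instance Definition _ := GRing.Lalgebra_isAlgebra.Build K
  {malg K[{fmonom I}]} fmalg_scaleAr.

End FreeAlgebra.

Section Enveloping.
Variables (K : fieldType) (L : lmodType K) (br : L -> L -> L).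

Local Notation F := {malg K[{fmonom L}]}.
Local Notation gen x := (<< fmu x >> : F).

(* F is the free algebra on the underlying set of L; the first family of
   relations turns it into the tensor algebra of L. *)
Inductive uea_rel : F -> Prop :=
| uea_rel_linear (c : K) (x y : L) :
    uea_rel (gen (c *: x + y) - (c *: gen x + gen y))
| uea_rel_bracket (x y : L) :
    uea_rel (gen x * gen y - gen y * gen x - gen (br x y)).

Definition uea : Type := mquot (ideal uea_rel).
HB.instance Definition _ := GRing.Lmodule.on uea.

Definition uea_pi (x : F) : uea := mquot_pi (ideal uea_rel) x.

Lemma uea_pi_is_linear : linear uea_pi.
Proof. exact: mquot_pi_is_linear. Qed.

HB.instance Definition _ :=
  GRing.isLinear.Build K F uea *:%R uea_pi uea_pi_is_linear.

Definition uea_repr (u : uea) : F := mquot_repr u.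

Lemma uea_reprK : cancel uea_repr uea_pi.
Proof. exact: mquot_reprK. Qed.

Lemma uea_eqP x y : uea_pi x = uea_pi y <-> in_ideal uea_rel (x - y).
Proof.
by split=> [/mquot_eqP/asboolP //|?]; apply/mquot_eqP/asboolP.
Qed.

End Enveloping.

HB.lock Definition uea_one (K : fieldType) (L : lmodType K)
    (br : L -> L -> L) : uea br :=
  uea_pi br 1.

HB.lock Definition uea_mul (K : fieldType) (L : lmodType K)
    (br : L -> L -> L) (u v : uea br) : uea br :=
  uea_pi br (uea_repr u * uea_repr v).

HB.lock Definition uea_in (K : fieldType) (L : lmodType K)
    (br : L -> L -> L) (x : L) : uea br :=
  uea_pi br << fmu x >>.

Section EnvelopingTheory.
Variables (K : fieldType) (L : lmodType K) (br : L -> L -> L).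
Local Notation F := {malg K[{fmonom L}]}.
Local Notation gen x := (<< fmu x >> : F).
Local Notation uea := (uea br).
Local Notation uea_rel := (uea_rel br).
Local Notation uea_pi := (uea_pi br).
Local Notation uea_one := (uea_one br).
Local Notation uea_repr := (@uea_repr K L br).
Local Notation uea_mul := (@uea_mul K L br).
Local Notation uea_in := (uea_in br).

Lemma uea_piM x y : uea_pi (x * y) = uea_mul (uea_pi x) (uea_pi y).
Proof.
rewrite uea_mul.unlock; apply/uea_eqP.
set x' := uea_repr _; set y' := uea_repr _.
have -> : x * y - x' * y' = (x - x') * y + x' * (y - y').
  by rewrite mulrBl mulrBr addrA subrK.
by apply: idealD; [apply: idealMr|apply: idealMl];
  apply/uea_eqP; rewrite uea_reprK.
Qed.

Lemma uea_mulA : associative uea_mul.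
Proof.
move=> u v w; rewrite -(uea_reprK u) -(uea_reprK v) -(uea_reprK w).
by rewrite -!uea_piM mulrA.
Qed.

Lemma uea_mul1 : left_id uea_one uea_mul.
Proof. by move=> u; rewrite -(uea_reprK u) uea_one.unlock -uea_piM mul1r. Qed.

Lemma uea_mulr1 : right_id uea_one uea_mul.
Proof. by move=> u; rewrite -(uea_reprK u) uea_one.unlock -uea_piM mulr1. Qed.

Lemma uea_mulDl : left_distributive uea_mul +%R.
Proof.
move=> u v w; rewrite -(uea_reprK u) -(uea_reprK v) -(uea_reprK w).
by rewrite -raddfD -!uea_piM mulrDl raddfD.
Qed.

Lemma uea_mulDr : right_distributive uea_mul +%R.
Proof.
move=> u v w; rewrite -(uea_reprK u) -(uea_reprK v) -(uea_reprK w).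
by rewrite -raddfD -!uea_piM mulrDr raddfD.
Qed.

Lemma uea_one_neq0 : uea_one != 0.
Proof.
pose aug : F -> K := mcoeff (mone : {fmonom L}).
have augD x y : aug (x + y) = aug x + aug y by exact: mcoeffD.
have augN x : aug (- x) = - aug x by exact: mcoeffN.
have augZ c x : aug (c *: x) = c * aug x by exact: mcoeffZ.
have augM x y : aug (x * y) = aug x * aug y.
  exact: (mcoeff1g_is_multiplicative _ _).1.
have aug_gen (x : L) : aug (gen x) = 0 by rewrite /aug mcoeffU fm1_eq1.
have aug0B x y : aug x = 0 -> aug y = 0 -> aug (x - y) = 0.
  by rewrite augD augN => -> ->; rewrite subr0.
have aug_rel x : in_ideal uea_rel x -> aug x = 0.
  elim=> {x} [x [c y z|y z]| |x y _ Ix _ Iy|a x _ Ix|a x _ Ix].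
  - apply: (aug0B); first exact: aug_gen.
    by rewrite augD augZ (aug_gen y) (aug_gen z) mulr0 addr0.
  - have augMgen t1 t2 : aug (gen t1 * gen t2) = 0.
      by rewrite augM (aug_gen t1) mul0r.
    apply: (aug0B); last exact: aug_gen.
    by apply: (aug0B); exact: augMgen.
  - exact: mcoeff0.
  - by rewrite augD Ix Iy addr0.
  - by rewrite augM Ix mulr0.
  - by rewrite augM Ix mul0r.
have aug1 : aug 1 = 1 by rewrite /aug mcoeff1 eqxx.
apply/eqP; rewrite uea_one.unlock -(raddf0 uea_pi) => /uea_eqP/aug_rel/eqP.
by rewrite subr0 aug1 oner_eq0.
Qed.

HB.instance Definition _ := GRing.Zmodule_isNzRing.Build uea
  uea_mulA uea_mul1 uea_mulr1 uea_mulDl uea_mulDr uea_one_neq0.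

Lemma uea_mulE x y : uea_pi x * uea_pi y = uea_pi (x * y).
Proof. exact: esym (uea_piM x y). Qed.

Lemma uea_pi_monoid_morphism : monoid_morphism uea_pi.
Proof.
have uea_pi1 : uea_one = uea_pi 1 by rewrite uea_one.unlock.
by split=> [|x y]; [exact: esym uea_pi1|exact: uea_piM].
Qed.

HB.instance Definition _ :=
  GRing.isMonoidMorphism.Build F uea uea_pi uea_pi_monoid_morphism.

Lemma uea_scaleAl (c : K) (u v : uea) : c *: (u * v) = c *: u * v.
Proof.
rewrite -(uea_reprK u) -(uea_reprK v) uea_mulE -!linearZ uea_mulE.
by rewrite scalerAl.
Qed.

HB.instance Definition _ := GRing.Lmodule_isLalgebra.Build K uea uea_scaleAl.

Lemma uea_scaleAr (c : K) (u v : uea) : c *: (u * v) = u * (c *: v).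
Proof.
rewrite -(uea_reprK u) -(uea_reprK v) uea_mulE -!linearZ uea_mulE.
by rewrite fmalg_scaleAr.
Qed.

HB.instance Definition _ := GRing.Lalgebra_isAlgebra.Build K uea uea_scaleAr.

Lemma uea_inE x : uea_in x = uea_pi (gen x).
Proof. by rewrite uea_in.unlock. Qed.

Lemma uea_in_is_linear : linear uea_in.
Proof.
move=> c x y; rewrite !uea_inE -linearZ -raddfD /=.
by apply/uea_eqP/ideal_gen; exact: uea_rel_linear.
Qed.

HB.instance Definition _ :=
  GRing.isLinear.Build K L uea *:%R uea_in uea_in_is_linear.

Lemma uea_in_br x y :
  uea_in (br x y) = uea_in x * uea_in y - uea_in y * uea_in x.
Proof.
rewrite !uea_inE -!rmorphM -raddfB /=; apply/esym/uea_eqP/ideal_gen.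
exact: uea_rel_bracket.
Qed.

End EnvelopingTheory.

Section Induced.
Variables (K : fieldType) (L : lmodType K) (br : L -> L -> L).
Variables (P : set L) (chi : L -> K).

(* For a subalgebra P of L with a one-dimensional module K_chi, the module
   U(L) (x)_{U(P)} K_chi is the quotient of U(L) by the relations
   u p (x) 1 = u (x) p 1 = chi(p) (u (x) 1), for u in U(L) and p in P. *)
Definition ind_rel : set (uea br) :=
  [set uea_in br p - (chi p)%:A | p in P].

Definition ind_mod : Type := mquot (lideal ind_rel).
HB.instance Definition _ := GRing.Lmodule.on ind_mod.

Definition ind_pi (u : uea br) : ind_mod := mquot_pi (lideal ind_rel) u.

Lemma ind_pi_is_linear : linear ind_pi.
Proof. exact: mquot_pi_is_linear. Qed.

HB.instance Definition _ :=
  GRing.isLinear.Build K (uea br) ind_mod *:%R ind_pi ind_pi_is_linear.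

Definition ind_repr (v : ind_mod) : uea br := mquot_repr v.

Lemma ind_reprK : cancel ind_repr ind_pi.
Proof. exact: mquot_reprK. Qed.

Lemma ind_eqP x y : ind_pi x = ind_pi y <-> in_lideal ind_rel (x - y).
Proof.
by split=> [/mquot_eqP/asboolP //|?]; apply/mquot_eqP/asboolP.
Qed.

Definition ind_vac : ind_mod := ind_pi 1.

End Induced.

HB.lock Definition ind_act (K : fieldType) (L : lmodType K)
    (br : L -> L -> L) (P : set L) (chi : L -> K)
    (x : L) (v : ind_mod br P chi) : ind_mod br P chi :=
  ind_pi P chi (uea_in br x * ind_repr v).

Section InducedTheory.
Variables (K : fieldType) (L : lmodType K) (br : L -> L -> L).
Variables (P : set L) (chi : L -> K).
Local Notation ind_rel := (ind_rel br P chi).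
Local Notation ind_mod := (ind_mod br P chi).
Local Notation ind_pi := (@ind_pi K L br P chi).
Local Notation ind_repr := (@ind_repr K L br P chi).
Local Notation ind_vac := (ind_vac br P chi).
Local Notation ind_act := (@ind_act K L br P chi).

Lemma ind_act_pi x u : ind_act x (ind_pi u) = ind_pi (uea_in br x * u).
Proof.
rewrite ind_act.unlock; apply/ind_eqP; rewrite -mulrBr; apply: lidealMl.
by apply/ind_eqP; rewrite ind_reprK.
Qed.

Lemma ind_act_is_linear x : linear (ind_act x).
Proof.
move=> c v w; rewrite -(ind_reprK v) -(ind_reprK w).
have ind_piP a b : c *: ind_pi a + ind_pi b = ind_pi (c *: a + b).
  exact: esym (linearP ind_pi c a b).
by rewrite ind_piP !ind_act_pi mulrDr -scalerAr ind_piP.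
Qed.

HB.instance Definition _ x := GRing.isLinear.Build K ind_mod ind_mod *:%R
  (ind_act x) (ind_act_is_linear x).

Lemma ind_act_linearl v : linear (ind_act^~ v).
Proof.
move=> c x y; rewrite -(ind_reprK v) !ind_act_pi.
rewrite (linearP (uea_in br)) mulrDl -scalerAl.
exact: (linearP ind_pi).
Qed.

Lemma ind_act_br x y v :
  ind_act (br x y) v = ind_act x (ind_act y v) - ind_act y (ind_act x v).
Proof.
by rewrite -(ind_reprK v) !ind_act_pi uea_in_br mulrBl -!mulrA raddfB.
Qed.

Lemma ind_act_vac p : P p -> ind_act p ind_vac = chi p *: ind_vac.
Proof.
move=> Pp; rewrite ind_act_pi mulr1 /ind_vac -linearZ; apply/ind_eqP.
by apply: lideal_gen; exists p.
Qed.

End InducedTheory.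

Section Affine.
Variables (K : fieldType) (g : lmodType K).
Variables (br : g -> g -> g) (form : g -> g -> K).

(* g (x) K[t, t^-1], as finitely supported functions int -> g *)
Definition loop : Type := {malg g[int]}.
HB.instance Definition _ := GRing.Zmodule.on loop.

Definition loop_scale (c : K) (f : loop) : loop :=
  [malg n in msupp f => c *: f@_n].

Lemma loop_scaleE c f n : (loop_scale c f)@_n = c *: f@_n.
Proof. by rewrite mcoeffE; case: msuppP => //; rewrite scaler0. Qed.

Lemma loop_scaleA a b f : loop_scale a (loop_scale b f) = loop_scale (a * b) f.
Proof. by apply/malgP => n; rewrite !loop_scaleE scalerA. Qed.

Lemma loop_scale1 : left_id 1 loop_scale.
Proof. by move=> f; apply/malgP => n; rewrite loop_scaleE scale1r. Qed.

Lemma loop_scaleDr : right_distributive loop_scale +%R.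
Proof.
move=> a f h; apply/malgP => n.
by rewrite mcoeffD !loop_scaleE mcoeffD scalerDr.
Qed.

Lemma loop_scaleDl f : {morph loop_scale^~ f : a b / a + b}.
Proof.
by move=> a b; apply/malgP => n; rewrite mcoeffD !loop_scaleE scalerDl.
Qed.

HB.instance Definition _ := GRing.Zmodule_isLmodule.Build K loop
  loop_scaleA loop_scale1 loop_scaleDr loop_scaleDl.

Definition affine : Type := (loop * K^o)%type.
HB.instance Definition _ := GRing.Lmodule.on affine.

Definition affine_t (h : g) (n : int) : affine := (<< h *g n >>, 0).
Definition affine_k : affine := (0, 1).

Definition affine_br (x y : affine) : affine :=
  (\sum_(m <- msupp x.1) \sum_(n <- msupp y.1)
     << br x.1@_m y.1@_n *g m + n >>,
   \sum_(m <- msupp x.1) m%:~R * form x.1@_m y.1@_(- m)).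

Definition affine_nonneg : set affine :=
  [set x | forall n : int, n < 0 -> x.1@_n = 0].

Definition affine_char (ell : K) (x : affine) : K := ell * x.2.

Lemma affine_br_tt h1 m h2 n :
  (forall h, br 0 h = 0) -> (forall h, br h 0 = 0) ->
  (forall h, form 0 h = 0) -> (forall h, form h 0 = 0) ->
  affine_br (affine_t h1 m) (affine_t h2 n) =
  affine_t (br h1 h2) (m + n)
    + (m%:~R * form h1 h2 * (m + n == 0)%:R) *: affine_k.
Proof.
move=> br0l br0r form0l form0r.
have sumU (V : nmodType) (h : g) (l : int) (E : g -> int -> V) :
    (forall i, E 0 i = 0) ->
    \sum_(i <- msupp << h *g l >>) E (<< h *g l >>@_i) i = E h l.
  move=> E0; rewrite (big_fset_incl _ (@msuppU_le _ _ l h)) => [|i _].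
    by rewrite big_seq_fset1 mcoeffUU.
  by move=> /mcoeff_outdom ->; rewrite E0.
set c := m%:~R * _ * _.
have -> : affine_t (br h1 h2) (m + n) + c *: affine_k =
    (<< br h1 h2 *g m + n >>, c) :> affine.
  rewrite /affine_t /affine_k; congr pair.
    by change ((<< br h1 h2 *g m + n >> : loop) + c *: (0 : loop) =
               << br h1 h2 *g m + n >>); rewrite scaler0 addr0.
  by change (0 + c * 1 = c); rewrite add0r mulr1.
rewrite /affine_br /affine_t /=; congr pair.
- rewrite (sumU _ _ _ (fun x i =>
      \sum_(j <- _) << br x << h2 *g n >>@_j *g i + j >>)).
    rewrite (sumU _ _ _ (fun y j => << br h1 y *g m + j >>)) // => j.
    by rewrite br0r monalgU0.
  by move=> i; rewrite big1 // => j _; rewrite br0l monalgU0.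
- rewrite (sumU _ _ _ (fun x i => i%:~R * form x << h2 *g n >>@_(- i))).
    rewrite mcoeffU -subr_eq0 opprK [n + m]addrC /c.
    by case: (m + n == 0); rewrite ?mulr1n ?mulr0n ?form0r ?mulr1 ?mulr0.
  by move=> i; rewrite form0l mulr0.
Qed.

End Affine.

Section LinearSets.
Variables (K : fieldType) (V : lmodType K).

Definition subspace (W : set V) : Prop :=
  W 0 /\ forall (c : K) (u v : V), W u -> W v -> W (c *: u + v).

Definition lspan (S : set V) : set V :=
  [set v | exists2 s : seq (K * V),
     (forall p, p \in s -> S p.2) & v = \sum_(p <- s) p.1 *: p.2].

Definition finite_dim (W : set V) : Prop :=
  exists s : seq V, W `<=` lspan [set` s].

(* V is the direct sum of the subspaces gr n, n : int *)
Record is_grading (gr : int -> set V) : Prop := {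
  grading_subspace : forall n, subspace (gr n);
  grading_sum : forall v, exists s : seq int, exists f : int -> V,
    (forall n, gr n (f n)) /\ v = \sum_(n <- s) f n;
  grading_direct : forall (s : seq int) (f : int -> V),
    uniq s -> (forall n, gr n (f n)) -> \sum_(n <- s) f n = 0 ->
    forall n, n \in s -> f n = 0 }.

End LinearSets.

(* m (m - 1) ... (m - i + 1) / i! for an integer m of any sign *)
Definition binz (K : fieldType) (m : int) (i : nat) : K :=
  (\prod_(j < i) (m - j%:Z))%:~R / i`!%:R.

Section Vertex.
Variables (K : fieldType) (V : lmodType K).

(* Y u n v is u_n v, where Y(u, x) = \sum_n u_n x^(-n-1) *)
Implicit Type Y : V -> int -> V -> V.

(* [va_jacobi] is the coefficient of x0^(-l-1) x1^(-m-1) x2^(-n-1) in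
     x0^-1 delta((x1 - x2)/x0) Y(u, x1) Y(v, x2)
     - x0^-1 delta((x2 - x1)/(-x0)) Y(v, x2) Y(u, x1)
     = x2^-1 delta((x1 - x0)/x2) Y(Y(u, x0) v, x2)
   applied to w. By [va_trunc] only finitely many terms of the sums over i
   are nonzero, hence the partial sums. *)
Record is_vertex_algebra (one : V) Y : Prop := {
  va_linearl : forall n v, linear (fun u => Y u n v);
  va_linearr : forall u n, linear (Y u n);
  va_trunc : forall u v, exists N : int, forall n, N <= n -> Y u n v = 0;
  va_vacuum : forall n v, Y one n v = if n == -1 then v else 0;
  va_creation0 : forall u (n : int), 0 <= n -> Y u n one = 0;
  va_creation : forall u, Y u (-1) one = u;
  va_jacobi : forall (u v w : V) (l m n : int),
    exists N : nat, forall M : nat, (N <= M)%N ->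
      \sum_(i < M) ((-1) ^+ i * binz K l i) *:
         (Y u (m + l - i%:Z) (Y v (n + i%:Z) w)
          - (-1) ^ l *: Y v (n + l - i%:Z) (Y u (m + i%:Z) w))
      = \sum_(i < M) binz K m i *: Y (Y u (l + i%:Z) v) (m + n - i%:Z) w }.

(* L(n) = omega_(n+1), that is, Y(omega, x) = \sum_n L(n) x^(-n-2) *)
Definition Lmode Y (omega : V) (n : int) : V -> V := Y omega (n + 1).

Record is_vertex_operator_algebra (one : V) Y (gr : int -> set V)
    (omega : V) (c : K) : Prop := {
  voa_va : is_vertex_algebra one Y;
  voa_grading : is_grading gr;
  voa_finite_dim : forall n, finite_dim (gr n);
  voa_lower : exists N : int, forall n, n < N -> gr n `<=` [set 0];
  voa_one : gr 0 one;
  voa_omega : gr 2 omega;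
  voa_virasoro : forall (m n : int) (v : V),
    Lmode Y omega m (Lmode Y omega n v) - Lmode Y omega n (Lmode Y omega m v)
    = (m - n)%:~R *: Lmode Y omega (m + n) v
      + (if m + n == 0 then (m ^+ 3 - m)%:~R / 12%:R * c else 0) *: v;
  voa_L0 : forall (n : int) (v : V),
    gr n v -> Lmode Y omega 0 v = n%:~R *: v;
  (* Y(L(-1) u, x) = d/dx Y(u, x) *)
  voa_derivative : forall (u v : V) (n : int),
    Y (Lmode Y omega (-1) u) n v = - n%:~R *: Y u (n - 1) v }.

Definition vertex_subalgebra (one : V) Y (W : set V) : Prop :=
  [/\ subspace W, W one &
      forall (u v : V) (n : int), W u -> W v -> W (Y u n v)].

Definition generates (one : V) Y (S : set V) : Prop :=
  forall W, vertex_subalgebra one Y W -> S `<=` W -> W = setT.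

End Vertex.

Section NappiWitten.
Variable K : fieldType.

Definition H4 : Type := 'rV[K]_4.
HB.instance Definition _ := GRing.Lmodule.on H4.

Definition nw_ia : 'I_4 := @Ordinal 4 0 isT.
Definition nw_ib : 'I_4 := @Ordinal 4 1 isT.
Definition nw_ic : 'I_4 := @Ordinal 4 2 isT.
Definition nw_id : 'I_4 := @Ordinal 4 3 isT.

Definition nw_a : H4 := delta_mx 0 nw_ia.
Definition nw_b : H4 := delta_mx 0 nw_ib.
Definition nw_c : H4 := delta_mx 0 nw_ic.
Definition nw_d : H4 := delta_mx 0 nw_id.

Definition nw_br (x y : H4) : H4 :=
  (x 0 nw_id * y 0 nw_ia - x 0 nw_ia * y 0 nw_id) *: nw_a
  - (x 0 nw_id * y 0 nw_ib - x 0 nw_ib * y 0 nw_id) *: nw_b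
  + (x 0 nw_ia * y 0 nw_ib - x 0 nw_ib * y 0 nw_ia) *: nw_c.

Definition nw_form (x y : H4) : K :=
  x 0 nw_ia * y 0 nw_ib + x 0 nw_ib * y 0 nw_ia
  + x 0 nw_ic * y 0 nw_id + x 0 nw_id * y 0 nw_ic.

Lemma nw_br_table :
  [/\ nw_br nw_a nw_b = nw_c, nw_br nw_d nw_a = nw_a,
      nw_br nw_d nw_b = - nw_b &
      forall x, nw_br nw_c x = 0].
Proof.
split=> [|||x]; apply/rowP => i; rewrite !mxE /=;
  by case: i => [[|[|[|[|i]]]] ?]; rewrite //=; ring.
Qed.

Lemma nw_form_table :
  [/\ nw_form nw_a nw_b = 1, nw_form nw_c nw_d = 1,
      forall x y, nw_form x y = nw_form y x &
      [/\ nw_form nw_a nw_a = 0, nw_form nw_b nw_b = 0,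
          nw_form nw_c nw_c = 0, nw_form nw_d nw_d = 0 &
          [/\ nw_form nw_a nw_c = 0, nw_form nw_a nw_d = 0,
              nw_form nw_b nw_c = 0 & nw_form nw_b nw_d = 0]]].
Proof. by rewrite /nw_form; do !split=> *; rewrite ?mxE /=; ring. Qed.

Lemma nw_br_anti x : nw_br x x = 0.
Proof. by apply/rowP => i; rewrite !mxE; ring. Qed.

Lemma nw_br_jacobi x y z :
  nw_br x (nw_br y z) + nw_br y (nw_br z x) + nw_br z (nw_br x y) = 0.
Proof.
apply/rowP => i; rewrite !mxE /=.
by case: i => [[|[|[|[|i]]]] ?]; rewrite //=; ring.
Qed.

Lemma nw_form_inv x y z : nw_form (nw_br x y) z = nw_form x (nw_br y z).
Proof. by rewrite /nw_form !mxE /=; ring. Qed.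

Definition H4hat : lmodType K := affine H4.
Definition H4hat_br : H4hat -> H4hat -> H4hat := affine_br nw_br nw_form.

Variable ell : K.

Definition VH4 : Type :=
  ind_mod H4hat_br (@affine_nonneg K H4) (affine_char ell).
HB.instance Definition _ := GRing.Lmodule.on VH4.

Definition vac : VH4 := ind_vac H4hat_br (@affine_nonneg K H4) (affine_char ell).

Definition mode (h : H4) (n : int) (v : VH4) : VH4 :=
  ind_act (affine_t h n : H4hat) v.

(* h^(1)(-m_1) ... h^(r)(-m_r) 1, for s = [:: (h^(1), m_1); ...; (h^(r), m_r)] *)
Definition monomial (s : seq (H4 * nat)) : VH4 :=
  foldr (fun p v => mode p.1 (- p.2%:Z) v) vac s.

Definition VH4_grade (n : int) : set VH4 :=
  lspan [set monomial s | s in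
    [set s | all (fun p => 0 < p.2)%N s /\ (\sum_(p <- s) p.2)%N%:Z = n]].

Definition omega : VH4 :=
  ell^-1 *: (mode nw_a (-1) (mode nw_b (-1) vac)
             + mode nw_c (-1) (mode nw_d (-1) vac))
  - (2%:R * ell)^-1 *: mode nw_c (-2) vac
  - (2%:R * ell ^+ 2)^-1 *: mode nw_c (-1) (mode nw_c (-1) vac).

End NappiWitten.

(* Main.v *)
(* The modes of Y(omega, x) are controlled by the commutator formula
   [u_m, v_n] = sum_i binom(m, i) (u_i v)_(m+n-i), the case l = 0 of the Jacobi
   identity. The products h_i omega (i >= 0) vanish except for
   h_1 omega = h(-1)1, which gives [h(n), L(m)] = n h(m+n); as V is spanned by
   the monomials applied to 1, this determines L(0), the products
   omega_i omega and hence the Virasoro relations. L(-1)u = u_(-2) 1 since both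
   sides satisfy the same recursion in u.

   Injectivity of h |-> h(-1)1 needs 1 <> 0. Instead of the PBW theorem, take a
   splitting L = P + N into subalgebras and define a functional on words in L
   recursively: a leading letter x acts by its P-component p, which is commuted
   to the right end and evaluated there by the character chi, while the
   N-component is killed. This functional vanishes on the relations of U(L) and
   on the left ideal defining the induced module, and equals 1 at the empty
   word. *)
Require Import Defs.
From HB Require Import structures.
From mathcomp Require Import all_boot all_order all_algebra.
From mathcomp Require Import ring zify finmap.
From mathcomp Require Import boolp classical_sets reals complex.
From mathcomp.multinomials Require Import monalg.

Set Implicit Arguments.
Unset Strict Implicit.
Unset Printing Implicit Defensive.
Import Order.TTheory GRing.Theory Num.Theory.
Local Open Scope classical_set_scope.
Local Open Scope ring_scope.

(** * The functional on words attached to a splitting of a Lie algebra *)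

Section WordFunctional.
Variables (K : fieldType) (L : lmodType K) (br : L -> L -> L).
Variables (pr : L -> L) (chi : L -> K).

(** The adjoint action of [p], extended to tensor words as a derivation and composed with [f]. *)
Fixpoint word_der (f : seq L -> K) (p : L) (w : seq L) : K :=
  if w is x :: w' then
    f (br p x :: w') + word_der (fun u => f (x :: u)) p w'
  else 0.

(** The fuel [n] replaces structural recursion: [word_der] evaluates the functional on modified
    tails, which keep the length of [w'] but are not subterms. The value 0 at exhausted fuel is
    never reached from [word_fun]. *)
Fixpoint word_fun_rec (n : nat) (w : seq L) : K :=
  match n, w with
  | _, [::] => 1
  | n'.+1, x :: w' =>
      word_der (word_fun_rec n') (pr x) w' + chi (pr x) * word_fun_rec n' w'
  | 0, _ :: _ => 0
  end.

Definition word_fun (w : seq L) : K := word_fun_rec (size w) w.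

Definition multilinear (f : seq L -> K) : Prop :=
  forall u c x y w, f (u ++ (c *: x + y) :: w)
                    = c * f (u ++ x :: w) + f (u ++ y :: w).

Lemma eq_word_der f g p w :
  (forall u, size u = size w -> f u = g u) -> word_der f p w = word_der g p w.
Proof.
elim: w f g => [//|x w IH] f g fg /=.
by rewrite fg //; congr (_ + _); apply: IH => u su; rewrite fg //= su.
Qed.

Lemma word_fun_cons x w :
  word_fun (x :: w) = word_der word_fun (pr x) w + chi (pr x) * word_fun w.
Proof.
rewrite {1}/word_fun /=; congr (_ + _).
by apply: eq_word_der => u; rewrite /word_fun => ->.
Qed.

Lemma word_derD f g p w :
  word_der (fun u => f u + g u) p w = word_der f p w + word_der g p w.
Proof.
elim: w f g => [|x w IH] f g /=; first by rewrite addr0.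
by rewrite IH addrACA.
Qed.

Lemma word_derM c f p w :
  word_der (fun u => c * f u) p w = c * word_der f p w.
Proof.
elim: w f => [|x w IH] f /=; first by rewrite mulr0.
by rewrite IH mulrDr.
Qed.

Lemma word_der_cat f p u w :
  word_der f p (u ++ w) = word_der (fun v => f (v ++ w)) p u
                          + word_der (fun v => f (u ++ v)) p w.
Proof.
elim: u f => [|x u IH] f /=; first by rewrite add0r.
by rewrite IH addrA.
Qed.

Hypothesis br_linl : forall z, linear (br^~ z).
Hypothesis br_linr : forall z, linear (br z).
Hypothesis br_anti : forall x y, br x y = - br y x.
Hypothesis br_jacobi :
  forall x y z, br x (br y z) = br (br x y) z + br y (br x z).
Hypothesis pr_lin : linear pr.
Hypothesis chi_lin : forall c x y, chi (c *: x + y) = c * chi x + chi y.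
(** With [pr] the projection onto P along N, the next three hypotheses say that P and N are closed
    under the bracket and that [chi] is a character of P. *)
Hypothesis pr_sub : forall x y, pr (br (pr x) (pr y)) = br (pr x) (pr y).
Hypothesis pr_compl : forall x y, pr (br (x - pr x) (y - pr y)) = 0.
Hypothesis chi_br : forall x y, chi (br (pr x) (pr y)) = 0.

Lemma multilinear_cons f x : multilinear f -> multilinear (fun u => f (x :: u)).
Proof. by move=> fl u c y z w; rewrite -!cat_cons fl. Qed.

Lemma word_der_linear f w c p q :
  multilinear f ->
  word_der f (c *: p + q) w = c * word_der f p w + word_der f q w.
Proof.
elim: w f => [|x w IH] f fl /=; first by rewrite mulr0 addr0.
rewrite br_linl (fl [::]) /= IH ?mulrDr; last exact: multilinear_cons.
by rewrite addrACA.
Qed.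

Lemma multilinear_word_der f p : multilinear f -> multilinear (word_der f p).
Proof.
move=> fl u c x y w; rewrite !word_der_cat /=.
have H : (fun v => f (v ++ (c *: x + y) :: w))
    = (fun v => c * f (v ++ x :: w) + f (v ++ y :: w)).
  by apply/funext => ?; rewrite fl.
rewrite H word_derD word_derM br_linr fl.
have -> : (fun v => f (u ++ (c *: x + y) :: v))
    = (fun v => c * f (u ++ x :: v) + f (u ++ y :: v)).
  by apply/funext => ?; rewrite fl.
rewrite word_derD word_derM; ring.
Qed.

Lemma multilinear_word_fun : multilinear word_fun.
Proof.
have rec n : multilinear (word_fun_rec n).
  elim: n => [|n IH] [|z u] c x y w /=; rewrite ?mulr0 ?addr0 //.
    rewrite pr_lin word_der_linear // chi_lin; ring.
  rewrite multilinear_word_der // IH; ring.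
by move=> u c x y w; rewrite /word_fun !size_cat /= rec.
Qed.

(** Terms in which [p] and [q] hit different letters cancel; where both hit the same letter, the
    Jacobi identity leaves the action of [br p q]. *)
Lemma word_der_comm f p q w : multilinear f ->
  word_der (word_der f p) q w - word_der (word_der f q) p w
  = word_der f (br p q) w.
Proof.
elim: w f => [|x w IH] f fl /=; first by rewrite subr0.
rewrite !word_derD -(IH (fun u => f (x :: u))); last exact: multilinear_cons.
have := fl [::] (-1) (br q (br p x)) (br p (br q x)) w.
have -> : -1 *: br q (br p x) + br p (br q x) = br (br p q) x.
  by rewrite [br p (br q x)]br_jacobi scaleN1r addrCA addNr addr0.
by move=> /= ->; ring.
Qed.

(** The bracket relation of U(L), in the context of two words. Induction on the length of the prefix
    [u]; the empty prefix carries the content. *)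
Lemma word_fun_swap u x y w :
  word_fun (u ++ x :: y :: w)
  = word_fun (u ++ y :: x :: w) + word_fun (u ++ br x y :: w).
Proof.
move: {2}(size u) (erefl (size u)) => n; elim: n u x y w => [|n IH] [] //.
  move=> x y w _ /=; have fl := multilinear_word_fun.
  have E z p : word_der (fun u => word_fun (z :: u)) p w =
      word_der (word_der word_fun (pr z)) p w
      + chi (pr z) * word_der word_fun p w.
    rewrite -word_derM -word_derD.
    by apply: eq_word_der => u _; rewrite word_fun_cons.
  have addl q r : word_fun (q + r :: w) = word_fun (q :: w) + word_fun (r :: w).
    by have := fl [::] 1 q r w; rewrite /= scale1r mul1r.
  have oppl q : word_fun (- q :: w) = - word_fun (q :: w).
    apply/eqP; rewrite -addr_eq0 -addl addNr; apply/eqP.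
    have /= := fl [::] 1 0 0 w; rewrite scaler0 addr0 mul1r => /eqP.
    by rewrite -subr_eq0 opprD addNKr oppr_eq0 => /eqP.
  (* This is the expansion of the bracket of the two N-components, which lies in N, so that
     [word_fun] vanishes on any word it leads. *)
  have brx : br (pr x) y - br (pr y) x
      = br x y + br (pr x) (pr y) - br (x - pr x) (y - pr y).
    have brBl q r s : br (q - r) s = br q s - br r s.
      by have := br_linl s (-1) r q; rewrite !scaleN1r ![- _ + _]addrC.
    have brBr q r s : br s (q - r) = br s q - br s r.
      by have := br_linr s (-1) r q; rewrite !scaleN1r ![- _ + _]addrC.
    rewrite (br_anti (pr y)) opprK brBl !brBr.
    rewrite [in RHS](addrC (br x y)) !opprB addrACA.
    by rewrite [br (pr x) (pr y) + _]addrC [br x y + _]addrC !subrK.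
  rewrite (word_fun_cons x) (word_fun_cons y (x :: w)) /= !E.
  have cross : word_fun (br (pr x) y :: w) - word_fun (br (pr y) x :: w)
      = word_fun (br x y :: w) + word_fun (br (pr x) (pr y) :: w).
    rewrite -oppl -addl brx -[RHS]addl.
    rewrite [in LHS]addl oppl (word_fun_cons (br (_ - _) _)) pr_compl.
    have d0 : word_der word_fun 0 w = 0.
      have := word_der_linear w (-1) 0 0 fl.
      by rewrite scaler0 addr0 mulN1r addNr.
    have c0 : chi 0 = 0.
      by have := chi_lin (-1) 0 0; rewrite scaler0 addr0 mulN1r addNr.
    by rewrite d0 c0 mul0r addr0 subr0.
  have := word_fun_cons (br (pr x) (pr y)) w.
  rewrite pr_sub chi_br mul0r addr0 => Epp.
  (* The terms with [chi] are symmetric in [x] and [y] and cancel; the iterated derivations differ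
     by the derivation along the bracket of the P-components, which [Epp] turns back into a value of
     [word_fun]. *)
  have Cc := word_der_comm (pr x) (pr y) w fl.
  apply/eqP; rewrite -subr_eq0; apply/eqP.
  have {cross}-> : word_fun (br x y :: w) =
    word_fun (br (pr x) y :: w) - word_fun (br (pr y) x :: w)
    - word_fun (br (pr x) (pr y) :: w) by rewrite cross addrK.
  rewrite Epp -Cc !word_fun_cons; ring.
(* Behind a letter [z], the derivation by [pr z] hits [u] or [w], where induction applies, or it
   hits [x] or [y], where the Jacobi identity recombines the two brackets. *)
move=> z u x y w [su]; rewrite !cat_cons !word_fun_cons IH //.
rewrite !word_der_cat /=.
have -> : word_der (fun v => word_fun (v ++ x :: y :: w)) (pr z) u
   = word_der (fun v => word_fun (v ++ y :: x :: w)
                        + word_fun (v ++ br x y :: w)) (pr z) u.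
  by apply: eq_word_der => v sv; rewrite IH // sv.
have -> : word_der (fun v => word_fun (u ++ x :: y :: v)) (pr z) w
   = word_der (fun v => word_fun (u ++ y :: x :: v)
                        + word_fun (u ++ br x y :: v)) (pr z) w.
  by apply: eq_word_der => v sv; rewrite IH.
rewrite !word_derD (IH u (br _ x)) // (IH u x) // (br_jacobi (pr z)).
have := multilinear_word_fun u 1 (br (br (pr z) x) y) (br x (br (pr z) y)) w.
rewrite scale1r mul1r => ->; ring.
Qed.

(** Letters in front of [p] can only replace it by a bracket of two elements of P; this is again in
    P, so by induction it is evaluated by [chi], which kills brackets. What remains is the factor
    [chi p]. *)
Lemma word_fun_rcons w p :
  pr p = p -> word_fun (w ++ [:: p]) = chi p * word_fun w.
Proof.
move=> prp; move: {2}(size w) (erefl (size w)) => n;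
  elim: n w p prp => [|n IH] [|x w] p prp //.
  by move=> _ /=; rewrite word_fun_cons /= prp /word_fun /= add0r.
move=> [sw]; rewrite cat_cons !word_fun_cons word_der_cat /= addr0 (IH w p) //.
have -> : word_der (fun v => word_fun (v ++ [:: p])) (pr x) w
   = word_der (fun v => chi p * word_fun v) (pr x) w.
  by apply: eq_word_der => v sv; rewrite IH // sv.
have prb : pr (br (pr x) p) = br (pr x) p by rewrite -prp pr_sub.
have cb : chi (br (pr x) p) = 0 by rewrite -prp chi_br.
by rewrite (IH _ _ prb sw) cb word_derM; ring.
Qed.

End WordFunctional.

(** * From functions on words to functionals on the free and the enveloping algebra *)

Lemma free_word_fun (K : fieldType) (I : choiceType) (f : seq I -> K) :
  exists2 ph : {malg K[{fmonom I}]} -> K,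
    (forall c x y, ph (c *: x + y) = c * ph x + ph y) &
    forall w, ph << FMonom w >> = f w.
Proof.
pose ph := mmap (idfun : K -> K) (fun w : {fmonom I} => f w).
exists ph => [c x y|w]; last by rewrite /ph mmapU mul1r.
have phD a b : ph (a + b) = ph a + ph b by exact: mmapD.
rewrite phD; congr (_ + _); rewrite /ph.
rewrite (mmapEw (msuppZ_le _ _)) mmapE big_distrr /=.
by apply: eq_bigr => i _; rewrite mcoeffZ mulrA.
Qed.

Lemma free_word_ind (K : fieldType) (I : choiceType)
    (T : {malg K[{fmonom I}]} -> K) :
  (forall c x y, T (c *: x + y) = c * T x + T y) ->
  (forall w, T << FMonom w >> = 0) -> forall x, T x = 0.
Proof.
move=> Tlin T0 x.
have Tz : T 0 = 0 by have := Tlin (-1) 0 0; rewrite scaler0 addr0 mulN1r addNr.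
rewrite (monalgE x); elim/big_ind: _ => [//|u v Tu Tv|w _].
  by have := Tlin 1 u v; rewrite scale1r mul1r Tu Tv addr0.
have -> : << x@_w *g w >> = x@_w *: << FMonom w >> + 0 :> {malg K[{fmonom I}]}.
  by rewrite addr0; apply/malgP => k;
    rewrite mcoeffZ !mcoeffU fmK mulrnAr mulr1.
by rewrite Tlin T0 Tz mulr0 addr0.
Qed.

Lemma free_word_cat (K : fieldType) (I : choiceType) (u w : seq I) :
  << FMonom (u ++ w) >> = << FMonom u >> * << FMonom w >>
    :> {malg K[{fmonom I}]}.
Proof.
rewrite malgM_def fgmulUU mulr1; congr (<< _ *g _ >>).
by apply: esym; exact: (fmmulE (FMonom u) (FMonom w)).
Qed.

Section WordAlgebra.
(* The free algebra is kept abstract here, since unification on {malg K[_]}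
   unfolds its product and does not terminate. *)
Variables (K : fieldType) (I : Type) (A : lalgType K) (e : seq I -> A).
Hypothesis sAr : forall c (x y : A), c *: (x * y) = x * (c *: y).
Hypothesis e_nil : e [::] = 1.
Hypothesis e_cat : forall u w, e (u ++ w) = e u * e w.
Hypothesis e_span : forall T : A -> K,
  (forall c x y, T (c *: x + y) = c * T x + T y) ->
  (forall w, T (e w) = 0) -> forall x, T x = 0.
Variable ph : A -> K.
Hypothesis ph_lin : forall c x y, ph (c *: x + y) = c * ph x + ph y.

(** Sandwiching between two words makes the claim stable under multiplication on both sides: it is
    linear in the multiplier [a], which may thus be taken to be a word and absorbed into [u] or
    [w]. *)
Lemma word_ideal_eq0 (rel : set A) :
  (forall x, rel x -> forall u w, ph (e u * x * e w) = 0) ->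
  forall x, in_ideal rel x -> ph x = 0.
Proof.
move=> rel0 x idx; suff: forall u w, ph (e u * x * e w) = 0.
  by move/(_ [::] [::]); rewrite e_nil mul1r mulr1.
elim: idx => {x} [x /rel0 //| |x y _ IHx _ IHy|a x _ IH|a x _ IH] u w.
- by have := ph_lin (-1) 0 0; rewrite mulr0 mul0r scaler0 addr0 mulN1r addNr.
- have := ph_lin 1 (e u * x * e w) (e u * y * e w).
  by rewrite scale1r mul1r IHx IHy addr0 mulrDr mulrDl.
- apply: (e_span (T := fun a => ph (e u * (a * x) * e w))) => [c y z|v].
    by rewrite -ph_lin mulrDl mulrDr mulrDl -!scalerAl -sAr -scalerAl.
  by rewrite mulrA -e_cat.
- apply: (e_span (T := fun a => ph (e u * (x * a) * e w))) => [c y z|v].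
    by rewrite -ph_lin mulrDr mulrDr mulrDl -!sAr -scalerAl.
  by rewrite mulrA -[_ * e v * e w]mulrA -e_cat.
Qed.

End WordAlgebra.

Section UeaFunctional.
Variables (K : fieldType) (L : lmodType K) (br : L -> L -> L).
Variable f : seq L -> K.
Hypothesis f_lin : multilinear f.
Hypothesis f_swap : forall u x y w,
  f (u ++ x :: y :: w) = f (u ++ y :: x :: w) + f (u ++ br x y :: w).

(** This and the next lemma check the hypothesis of [word_ideal_eq0] on the two families of
    relations of U(L). *)
Lemma word_rel_linear (A : lalgType K) (e : seq L -> A) (ph : A -> K) :
  (forall c (x y : A), c *: (x * y) = x * (c *: y)) ->
  (forall u w, e (u ++ w) = e u * e w) ->
  (forall c x y, ph (c *: x + y) = c * ph x + ph y) ->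
  (forall w, ph (e w) = f w) ->
  forall c x y u w,
  ph (e u * (e [:: c *: x + y] - (c *: e [:: x] + e [:: y])) * e w) = 0.
Proof.
move=> sAr e_cat ph_lin ph_e c x y u w.
rewrite mulrBr mulrDr -sAr mulrBl mulrDl -scalerAl -!e_cat.
rewrite addrC -scaleN1r !ph_lin !ph_e -!catA !cat_cons !cat0s f_lin mulN1r.
by rewrite addNr.
Qed.

Lemma word_rel_bracket (A : lalgType K) (e : seq L -> A) (ph : A -> K) :
  (forall u w, e (u ++ w) = e u * e w) ->
  (forall c x y, ph (c *: x + y) = c * ph x + ph y) ->
  (forall w, ph (e w) = f w) ->
  forall x y u w,
  ph (e u * (e [:: x] * e [:: y] - e [:: y] * e [:: x] - e [:: br x y]) * e w)
  = 0.
Proof.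
move=> e_cat ph_lin ph_e x y u w.
have phB a b : ph (a - b) = ph a - ph b.
  by rewrite addrC -scaleN1r ph_lin mulN1r addrC.
rewrite -!e_cat !mulrBr !mulrBl -!e_cat !phB !ph_e -!catA /= f_swap; ring.
Qed.

Lemma uea_pi_cons x (w : seq L) :
  uea_pi br << FMonom (x :: w) >> = uea_in br x * uea_pi br << FMonom w >>.
Proof.
by rewrite -cat1s free_word_cat (rmorphM (uea_pi br)) /= uea_inE fmuE.
Qed.

Lemma uea_fun_ex : exists2 ps : uea br -> K,
    (forall c x y, ps (c *: x + y) = c * ps x + ps y) &
    forall w : seq L, ps (foldr (fun x a => uea_in br x * a) 1 w) = f w.
Proof.
have [ph ph_lin ph_e] := free_word_fun f.
pose e (w : seq L) : {malg K[{fmonom L}]} := << FMonom w >>.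
have e_cat u w : e (u ++ w) = e u * e w by exact: free_word_cat.
have ph0 : forall x, in_ideal (uea_rel br) x -> ph x = 0.
  apply: (word_ideal_eq0 (@fmalg_scaleAr K L) (e := e)) => //.
  - by rewrite /e -fmoneE.
  - exact: free_word_ind.
  - move=> _ [c x y|x y] u w; rewrite !fmuE.
      exact: (word_rel_linear (@fmalg_scaleAr K L) e_cat ph_lin ph_e).
    exact: (word_rel_bracket e_cat ph_lin ph_e).
have ph_eq x y : uea_pi br x = uea_pi br y -> ph x = ph y.
  move=> /uea_eqP/ph0; have := ph_lin (-1) y x.
  by rewrite scaleN1r addrC mulN1r => -> /eqP; rewrite addrC subr_eq0 => /eqP.
have foldE w : foldr (fun x a => uea_in br x * a) 1 w = uea_pi br (e w).
  elim: w => [|x w IH]; first by rewrite /e -fmoneE (rmorph1 (uea_pi br)).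
  by rewrite /= IH /e uea_pi_cons.
(* The representative of a class does not depend linearly on it, but by [ph_eq] the value of [ph]
   depends on the class alone. *)
exists (fun a => ph (uea_repr a)) => [c x y|w]; last first.
  by rewrite foldE -ph_e; apply: ph_eq; rewrite uea_reprK.
rewrite -ph_lin; apply: ph_eq; rewrite uea_reprK.
have /= := linearP (uea_pi br) c (uea_repr x) (uea_repr y).
by rewrite !uea_reprK => ->.
Qed.

Lemma uea_word_ind (W : set (uea br)) :
  subspace W -> W 1 -> (forall x a, W a -> W (uea_in br x * a)) ->
  forall a, W a.
Proof.
move=> [W0 Wlin] W1 Wmul a; rewrite -(uea_reprK a) (monalgE (uea_repr a)).
rewrite raddf_sum; elim/big_ind: _ => [//|u v Wu Wv|w _].
  by rewrite -[u]scale1r; apply: Wlin.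
set c := _@_w.
have -> : << c *g w >> = c *: << w >> :> {malg K[{fmonom L}]}.
  by apply/malgP => k; rewrite mcoeffZ !mcoeffU mulrnAr mulr1.
have /= := linearP (uea_pi br) c << w >> 0.
rewrite (raddf0 (uea_pi br)) addr0 => ->; apply: Wlin => //.
case: w c => w _; elim: w => [|x w IH].
  by rewrite -fmoneE (rmorph1 (uea_pi br)).
by rewrite uea_pi_cons; apply: Wmul.
Qed.

End UeaFunctional.

(** * Nonvanishing of the vacuum of an induced module *)

Section InducedVacuum.
Variables (K : fieldType) (L : lmodType K) (br : L -> L -> L).
Variables (P : set L) (pr : L -> L) (chi : L -> K).

Lemma ind_mod_ind (W : set (ind_mod br P chi)) :
  subspace W -> W (ind_vac br P chi) -> (forall x v, W v -> W (ind_act x v)) ->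
  forall v, W v.
Proof.
move=> [W0 Wlin] W1 Wact v; rewrite -(ind_reprK v).
apply: (uea_word_ind (W := fun a => W (ind_pi P chi a))) => //.
  split=> [|c a b Wa Wb]; first by rewrite (raddf0 (@ind_pi K L br P chi)).
  by rewrite (linearP (@ind_pi K L br P chi)); apply: Wlin.
by move=> x a Wa; rewrite -ind_act_pi; apply: Wact.
Qed.

Hypothesis br_linl : forall z, linear (br^~ z).
Hypothesis br_linr : forall z, linear (br z).
Hypothesis br_anti : forall x y, br x y = - br y x.
Hypothesis br_jacobi :
  forall x y z, br x (br y z) = br (br x y) z + br y (br x z).
Hypothesis pr_lin : linear pr.
Hypothesis chi_lin : forall c x y, chi (c *: x + y) = c * chi x + chi y.
Hypothesis pr_id : forall p, P p -> pr p = p.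
Hypothesis pr_sub : forall x y, pr (br (pr x) (pr y)) = br (pr x) (pr y).
Hypothesis pr_compl : forall x y, pr (br (x - pr x) (y - pr y)) = 0.
Hypothesis chi_br : forall x y, chi (br (pr x) (pr y)) = 0.

(** The functional induced by [word_fun] on U(L) is 1 at 1 and vanishes on the left ideal that is
    divided out. *)
Lemma ind_vac_neq0 : ind_vac br P chi != 0.
Proof.
pose f := word_fun br pr chi.
have f_lin : multilinear f by exact: multilinear_word_fun.
have f_swap : forall u x y w,
    f (u ++ x :: y :: w) = f (u ++ y :: x :: w) + f (u ++ br x y :: w).
  by move=> u x y w; rewrite /f word_fun_swap.
have [ps ps_lin ps_w] := uea_fun_ex f_lin f_swap.
have psB a b : ps (a - b) = ps a - ps b.
  by rewrite addrC -scaleN1r ps_lin mulN1r addrC.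
have ps0 : ps 0 = 0 by rewrite -(subrr 0) psB subrr.
pose word w := foldr (fun x a => uea_in br x * a) 1 w.
have wordE w x : word (w ++ [:: x]) = word w * uea_in br x.
  rewrite /word foldr_cat /= mulr1.
  by elim: w => [|y w IH] /=; rewrite ?mul1r // IH mulrA.
(* The words span U(L), so a left multiplier may be taken to be a word. *)
have ps_word d : (forall w, ps (word w * d) = 0) -> forall b, ps (b * d) = 0.
  move=> H b; pose W := [set b | forall w, ps (word w * b * d) = 0].
  suff /(_ [::]) : W b by rewrite mul1r.
  apply: uea_word_ind => [|w|x a Wa w]; last 2 first.
  - by rewrite mulr1.
  - by rewrite mulrA -wordE.
  split=> [w|c u v Wu Wv w]; first by rewrite mulr0 mul0r ps0.
  by rewrite mulrDr -scalerAr mulrDl -scalerAl ps_lin Wu Wv mulr0 addr0.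
(* Quantifying over [b] absorbs left multiplication; on a generator the claim is
   [word_fun_rcons]. *)
have psid a : in_lideal (@ind_rel K L br P chi) a -> forall b, ps (b * a) = 0.
  elim=> {a} [_ [p Pp <-]| |x y _ IHx _ IHy|a x _ IH] b.
  - apply: ps_word => w; rewrite mulrBr -scalerAr mulr1.
    rewrite psB -wordE -[_ *: _]addr0 ps_lin ps0 addr0 !ps_w /f.
    by rewrite word_fun_rcons ?subrr // pr_id.
  - by rewrite mulr0 ps0.
  - by rewrite mulrDr -[_ * x]scale1r ps_lin IHx IHy mulr0 addr0.
  - by rewrite mulrA.
apply/eqP; rewrite -(raddf0 (@ind_pi K L br P chi)) => /ind_eqP/psid/(_ 1).
rewrite mul1r subr0 => /eqP; have := ps_w [::] => /= ->.
by rewrite /f /word_fun /= oner_eq0.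
Qed.

End InducedVacuum.

(** * The affinization as a Lie algebra, and its splitting into nonnegative and negative modes *)

Section AffineLie.
Variables (K : fieldType) (g : lmodType K).
Local Notation affine := (affine g).

Lemma loop_gen_linear n : linear (fun h : g => << h *g n >> : loop g).
Proof.
move=> c x y; apply/malgP => k; rewrite mcoeffD loop_scaleE !mcoeffU.
by case: eqP => _; rewrite ?scaler0 ?addr0.
Qed.

Lemma affine_t_linear n : linear (fun h : g => affine_t h n : affine).
Proof.
move=> c x y; congr pair; last by change (0 = c * 0 + 0 :> K);
  rewrite mulr0 addr0.
exact: loop_gen_linear.
Qed.

Lemma affine_decomp (x : affine) :
  x = (x.2 : K) *: (affine_k g : affine)
      + \sum_(n <- msupp x.1) affine_t x.1@_n n.
Proof.
have E2 : (\sum_(n <- msupp x.1) affine_t x.1@_n n : affine).2 = 0.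
  by elim/big_ind: _ => [//|u v /= -> ->|//]; rewrite addr0.
have E1 : (\sum_(n <- msupp x.1) affine_t x.1@_n n : affine).1 = x.1.
  rewrite [RHS]monalgE.
  by elim/big_rec2: _ => [//|n u v _ /= <-].
move: E1 E2; set s := \sum_(n <- _) _; move: s => [s1 s2] /= -> ->.
case: x => x1 x2 /=; congr pair.
  by change (x1 = (x2 : K) *: (0 : loop g) + x1); rewrite scaler0 add0r.
by change (x2 = x2 * 1 + 0 :> K); rewrite mulr1 addr0.
Qed.

(** Applied in each argument in turn, this reduces the Lie algebra axioms to the central element and
    the elements h (x) t^n. *)
Lemma affine_lin_eq (V : lmodType K) (f f' : affine -> V) :
  linear f -> linear f' -> f (affine_k g) = f' (affine_k g) ->
  (forall h n, f (affine_t h n) = f' (affine_t h n)) -> forall x, f x = f' x.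
Proof.
move=> fl fl' fk ft x.
have f0 e : linear e -> e 0 = 0 :> V.
  by move=> el; have := el (-1) 0 0; rewrite scaler0 addr0 scaleN1r addNr.
rewrite (affine_decomp x) fl fl' fk; congr (_ + _).
elim/big_ind: _ => [|u v Eu Ev|n _]; [by rewrite !f0| |exact: ft].
by have := fl 1 u v; have := fl' 1 u v; rewrite !scale1r Eu Ev => -> ->.
Qed.

Variables (br : g -> g -> g) (form : g -> g -> K).
Hypothesis br_linl : forall z, linear (br^~ z).
Hypothesis br_linr : forall z, linear (br z).
Hypothesis form_linl : forall z c x y,
  form (c *: x + y) z = c * form x z + form y z.
Hypothesis form_linr : forall z c x y,
  form z (c *: x + y) = c * form z x + form z y.

Lemma linear_eq0 (U V : lmodType K) (f : U -> V) : linear f -> f 0 = 0.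
Proof. by move=> fl; have := fl (-1) 0 0;
  rewrite scaler0 addr0 scaleN1r addNr. Qed.

Let br0l h : br 0 h = 0. Proof. exact: linear_eq0 (br_linl h). Qed.
Let br0r h : br h 0 = 0. Proof. exact: linear_eq0 (br_linr h). Qed.
Let form0l h : form 0 h = 0.
Proof. by have := form_linl h (-1) 0 0; rewrite scaler0 addr0 mulN1r addNr. Qed.
Let form0r h : form h 0 = 0.
Proof. by have := form_linr h (-1) 0 0; rewrite scaler0 addr0 mulN1r addNr. Qed.

Local Notation abr := (affine_br br form).

(** The supports of [x], [y] and [c *: x + y] differ; summing over a common larger set lets
    bilinearity be checked term by term. *)
Lemma affine_brE (d1 d2 : {fset int}) (x y : affine) :
  (msupp x.1 `<=` d1)%fset -> (msupp y.1 `<=` d2)%fset ->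
  abr x y = (\sum_(m <- d1) \sum_(n <- d2) << br x.1@_m y.1@_n *g m + n >>,
             \sum_(m <- d1) m%:~R * form x.1@_m y.1@_(- m)).
Proof.
move=> s1 s2; congr pair.
  rewrite (big_fset_incl _ s1) => [|m _ /mcoeff_outdom ->]; last first.
    by rewrite big1 // => n _; rewrite br0l monalgU0.
  apply: eq_bigr => m _; apply: big_fset_incl => // n _ /mcoeff_outdom ->.
  by rewrite br0r monalgU0.
by apply: big_fset_incl => // m _ /mcoeff_outdom ->; rewrite form0l mulr0.
Qed.

Lemma affine_coef c (x y : affine) m :
  (c *: x + y).1@_m = c *: x.1@_m + y.1@_m.
Proof. by rewrite mcoeffD loop_scaleE. Qed.

Lemma affine_br_linl z : linear (abr^~ z).
Proof.
move=> c x y; pose xy : affine := c *: x + y.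
pose d := (msupp x.1 `|` msupp y.1 `|` msupp xy.1)%fset.
have sx : (msupp x.1 `<=` d)%fset by rewrite /d -fsetUA fsubsetUl.
have sy : (msupp y.1 `<=` d)%fset by rewrite /d fsetUAC fsubsetUr.
have sz : (msupp xy.1 `<=` d)%fset by rewrite fsubsetUr.
rewrite !(affine_brE _ (fsubset_refl _) (d1 := d)) //; congr pair => /=.
  rewrite scaler_sumr -big_split; apply: eq_bigr => m _ /=.
  rewrite scaler_sumr -big_split; apply: eq_bigr => n _ /=.
  rewrite affine_coef br_linl; exact: loop_gen_linear.
rewrite scaler_sumr -big_split; apply: eq_bigr => m _ /=.
by rewrite affine_coef form_linl mulrDr mulrCA.
Qed.

Lemma affine_br_linr z : linear (abr z).
Proof.
move=> c x y; pose xy : affine := c *: x + y.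
pose d := (msupp x.1 `|` msupp y.1 `|` msupp xy.1)%fset.
have sx : (msupp x.1 `<=` d)%fset by rewrite /d -fsetUA fsubsetUl.
have sy : (msupp y.1 `<=` d)%fset by rewrite /d fsetUAC fsubsetUr.
have sz : (msupp xy.1 `<=` d)%fset by rewrite fsubsetUr.
rewrite !(affine_brE (fsubset_refl _) (d2 := d)) //; congr pair => /=.
  rewrite scaler_sumr -big_split; apply: eq_bigr => m _ /=.
  rewrite scaler_sumr -big_split; apply: eq_bigr => n _ /=.
  rewrite affine_coef br_linr; exact: loop_gen_linear.
rewrite scaler_sumr -big_split; apply: eq_bigr => m _ /=.
by rewrite affine_coef form_linr mulrDr mulrCA.
Qed.

Lemma affine_br_kl x : abr (affine_k g) x = 0.
Proof. by congr pair; rewrite msupp0 big_seq_fset0. Qed.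

Lemma affine_br_kr x : abr x (affine_k g) = 0.
Proof.
congr pair; rewrite big1 // => m _; first by rewrite msupp0 big_seq_fset0.
by rewrite mcoeff0 form0r mulr0.
Qed.

Lemma affine_br_t h1 m h2 n : abr (affine_t h1 m) (affine_t h2 n) =
  (m%:~R * form h1 h2 * (m + n == 0)%:R) *: affine_k g
  + affine_t (br h1 h2) (m + n).
Proof. by rewrite affine_br_tt // addrC. Qed.

Hypothesis br_anti : forall x y, br x y = - br y x.
Hypothesis br_jacobi :
  forall x y z, br x (br y z) = br (br x y) z + br y (br x z).
Hypothesis form_sym : forall x y, form x y = form y x.
Hypothesis form_inv : forall x y z, form (br x y) z = form x (br y z).

Let linN (V : lmodType K) (f : affine -> V) :
  linear f -> linear (fun x => - f x).
Proof. by move=> fl c x y; rewrite fl opprD scalerN. Qed.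
Let linD (V : lmodType K) (f f' : affine -> V) :
  linear f -> linear f' -> linear (fun x => f x + f' x).
Proof. by move=> fl fl' c x y; rewrite fl fl' scalerDr addrACA. Qed.
Let linC (U V : lmodType K) (f : affine -> U) (f' : U -> V) :
  linear f -> linear f' -> linear (fun x => f' (f x)).
Proof. by move=> fl fl' c x y; rewrite fl fl'. Qed.

Lemma affine_br_anti x y : abr x y = - abr y x.
Proof.
move: x; apply: affine_lin_eq; [exact: affine_br_linl| | |move=> h m].
- exact/linN/affine_br_linr.
- by rewrite affine_br_kl affine_br_kr oppr0.
move: y; apply: affine_lin_eq; [exact: affine_br_linr| | |move=> h' n].
- exact/linN/affine_br_linl.
- by rewrite affine_br_kl affine_br_kr oppr0.
have oppP (V : lmodType K) (a b : K) (k u v : V) :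
    a = - b -> u = - v -> a *: k + u = - (b *: k + v).
  by move=> -> ->; rewrite opprD scaleNr.
rewrite !affine_br_t; apply: oppP.
  rewrite [n + m]addrC; case: (altP eqP) => [mn|]; last by rewrite !mulr0 oppr0.
  have -> : m = - n by apply/eqP; rewrite -addr_eq0 mn.
  by rewrite mulrNz form_sym !mulr1 mulNr.
rewrite br_anti addrC -scaleN1r -[_ *: _]addr0 affine_t_linear.
by rewrite (linear_eq0 (affine_t_linear _)) addr0 scaleN1r.
Qed.

Lemma affine_br_jacobi x y z :
  abr x (abr y z) = abr (abr x y) z + abr y (abr x z).
Proof.
have Ll := affine_br_linl; have Lr := affine_br_linr.
move: x; apply: affine_lin_eq; [exact: Ll| | |move=> h1 m].
- apply: linD; first exact: (linC (Ll y) (Ll z)).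
  exact: (linC (Ll z) (Lr y)).
- by rewrite !affine_br_kl (linear_eq0 (Ll z)) (linear_eq0 (Lr y)) addr0.
move: y; apply: affine_lin_eq; [exact: (linC (Ll z) (Lr _))| | |move=> h2 n].
- apply: linD; first exact: (linC (Lr _) (Ll z)).
  exact: Ll.
- by rewrite !affine_br_kl affine_br_kr (linear_eq0 (Ll z)) (linear_eq0 (Lr _)) addr0.
move: z; apply: affine_lin_eq; [exact: (linC (Lr _) (Lr _))| | |move=> h3 p].
- apply: linD; first exact: Lr.
  exact: (linC (Lr _) (Lr _)).
- by rewrite !affine_br_kr !(linear_eq0 (Lr _)) addr0.
rewrite !affine_br_t !Lr !Ll !affine_br_kr !affine_br_kl !scaler0 !add0r.
rewrite !affine_br_t br_jacobi.
have tD u v k : affine_t (u + v) k = affine_t u k + affine_t v k :> affine.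
  by have := affine_t_linear k 1 u v; rewrite !scale1r.
have addP (V : lmodType K) (a a1 a2 : K) (k u u1 u2 : V) :
    a = a1 + a2 -> u = u1 + u2 -> a *: k + u = a1 *: k + u1 + (a2 *: k + u2).
  by move=> -> ->; rewrite addrACA scalerDl.
rewrite [n + (m + p)]addrCA -[m + n + p]addrA; apply: addP; last exact: tD.
(* By invariance all three central terms are multiples of the form of [br h1 h2] and [h3], with m =
   (m + n) - n. *)
rewrite -form_inv -form_inv (br_anti h2 h1).
have -> : form (- br h1 h2) h3 = - form (br h1 h2) h3.
  have := form_linl h3 (-1) (br h1 h2) 0.
  by rewrite addr0 scaleN1r mulN1r form0l addr0.
by rewrite rmorphD; ring.
Qed.

(** The projection onto P = g (x) K[t] + K k along N = g (x) t^-1 K[t^-1]. *)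
Definition affine_pr (x : affine) : affine :=
  ([malg n in msupp x.1 => if 0 <= n then x.1@_n else 0], x.2).

Lemma affine_prE x n : (affine_pr x).1@_n = if 0 <= n then x.1@_n else 0.
Proof. by rewrite mcoeffE; case: msuppP => // _; rewrite if_same. Qed.

Lemma affine_pr_linear : linear affine_pr.
Proof.
move=> c x y; congr pair; apply/malgP => n.
rewrite mcoeffD loop_scaleE !affine_prE affine_coef.
by case: ifP => _; rewrite ?scaler0 ?addr0.
Qed.

Lemma affine_pr_id x : affine_nonneg x -> affine_pr x = x.
Proof.
case: x => x1 x2 xn; congr pair; apply/malgP => n; rewrite affine_prE.
by case: ifPn => //; rewrite -ltNge => /xn.
Qed.

Lemma affine_pr_t h n :
  affine_pr (affine_t h n) = if 0 <= n then affine_t h n else 0.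
Proof.
case: ifPn => n0.
  congr pair; apply/malgP => k; rewrite affine_prE [_.1]/= mcoeffU.
  by case: ifPn => // k0; case: eqP => // nk; move: k0; rewrite -nk n0.
change (affine_pr (affine_t h n) = (0 : loop g, 0 : K^o)).
congr pair; apply/malgP => k; rewrite affine_prE [_.1]/= mcoeffU mcoeff0.
by case: ifPn => // k0; case: eqP => // nk; move: n0; rewrite nk k0.
Qed.

Lemma affine_pr_k : affine_pr (affine_k g) = affine_k g.
Proof. by apply: affine_pr_id => n _; rewrite mcoeff0. Qed.

Lemma affine_pr_sub x y :
  affine_pr (abr (affine_pr x) (affine_pr y)) = abr (affine_pr x) (affine_pr y).
Proof.
have Ll := affine_br_linl; have Lr := affine_br_linr;
  have Lp := affine_pr_linear.
move: x; apply: affine_lin_eq; [exact: (linC (linC Lp (Ll _)) Lp)|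
  exact: (linC Lp (Ll _))| |move=> h m].
  by rewrite affine_pr_k affine_br_kl (linear_eq0 Lp).
rewrite affine_pr_t; case: ifP => m0; last first.
  by rewrite (linear_eq0 (Ll _)) (linear_eq0 Lp).
move: y; apply: affine_lin_eq; [exact: (linC (linC Lp (Lr _)) Lp)|
  exact: (linC Lp (Lr _))| |move=> h' n].
  by rewrite affine_pr_k affine_br_kr (linear_eq0 Lp).
rewrite affine_pr_t; case: ifP => n0; last first.
  by rewrite (linear_eq0 (Lr _)) (linear_eq0 Lp).
by rewrite affine_br_t Lp affine_pr_k affine_pr_t addr_ge0.
Qed.

(** Two negative degrees add up to a negative one, so the cocycle vanishes and the bracket stays in
    N. *)
Lemma affine_pr_compl x y :
  affine_pr (abr (x - affine_pr x) (y - affine_pr y)) = 0.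
Proof.
have Ll := affine_br_linl; have Lr := affine_br_linr;
  have Lp := affine_pr_linear.
have Ln : linear (fun x => x - affine_pr x).
  by apply: linD => //; apply: linN.
have L0 : linear (fun _ : affine => 0 : affine).
  by move=> c u v; rewrite scaler0 addr0.
move: x; apply: affine_lin_eq; [exact: (linC (linC Ln (Ll _)) Lp)|exact: L0| |
  move=> h m].
  by rewrite affine_pr_k subrr (linear_eq0 (Ll _)) (linear_eq0 Lp).
rewrite affine_pr_t; case: ifPn => m0.
  by rewrite subrr (linear_eq0 (Ll _)) (linear_eq0 Lp).
move: y; apply: affine_lin_eq; [exact: (linC (linC Ln (Lr _)) Lp)|exact: L0| |
  move=> h' n].
  by rewrite affine_pr_k subrr (linear_eq0 (Lr _)) (linear_eq0 Lp).
rewrite affine_pr_t; case: ifPn => n0.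
  by rewrite subrr (linear_eq0 (Lr _)) (linear_eq0 Lp).
rewrite !subr0 affine_br_t Lp affine_pr_k affine_pr_t.
have mn : m + n < 0 by move: m0 n0; rewrite -!ltNge => ? ?; lia.
by rewrite (lt_eqF mn) mulr0 scale0r add0r leNgt mn.
Qed.

(** Degrees m and -m are both nonnegative only for m = 0, where the cocycle carries the factor m. *)
Lemma affine_char_br ell x y :
  affine_char ell (abr (affine_pr x) (affine_pr y)) = 0.
Proof.
rewrite /affine_char /= big1 ?mulr0 // => m _; rewrite !affine_prE oppr_ge0.
case: (ltgtP m 0) => [| |->]; rewrite ?form0l ?form0r ?mulr0 //=.
by rewrite mul0r.
Qed.

Lemma affine_vac_neq0 ell :
  ind_vac abr (@affine_nonneg K g) (affine_char ell) != 0.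
Proof.
apply: (@ind_vac_neq0 _ _ _ _ affine_pr).
- exact: affine_br_linl.
- exact: affine_br_linr.
- exact: affine_br_anti.
- exact: affine_br_jacobi.
- exact: affine_pr_linear.
- by move=> c x y; rewrite /affine_char mulrDr mulrCA.
- exact: affine_pr_id.
- exact: affine_pr_sub.
- exact: affine_pr_compl.
- exact: affine_char_br.
Qed.

End AffineLie.

(** * The Nappi-Witten algebra and the action of its modes on the vacuum module *)

Section NappiWittenModule.
Variable K : fieldType.
Local Notation H4 := (H4 K).

Lemma nw_br_linl z : linear (fun x : H4 => nw_br x z).
Proof.
move=> c x y; apply/rowP => i; rewrite !mxE /=.
by case: i => [[|[|[|[|i]]]] ?]; rewrite //=; ring.
Qed.

Lemma nw_br_linr z : linear (fun x : H4 => nw_br z x).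
Proof.
move=> c x y; apply/rowP => i; rewrite !mxE /=.
by case: i => [[|[|[|[|i]]]] ?]; rewrite //=; ring.
Qed.

Lemma nw_form_linl (z : H4) c (x y : H4) :
  nw_form (c *: x + y) z = c * nw_form x z + nw_form y z.
Proof. by rewrite /nw_form !mxE; ring. Qed.

Lemma nw_form_linr (z : H4) c (x y : H4) :
  nw_form z (c *: x + y) = c * nw_form z x + nw_form z y.
Proof. by rewrite /nw_form !mxE; ring. Qed.

Lemma nw_br_sym (x y : H4) : nw_br x y = - nw_br y x.
Proof.
apply/rowP => i; rewrite !mxE /=.
by case: i => [[|[|[|[|i]]]] ?]; rewrite //=; ring.
Qed.

Lemma nw_br_leibniz (x y z : H4) :
  nw_br x (nw_br y z) = nw_br (nw_br x y) z + nw_br y (nw_br x z).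
Proof.
apply/rowP => i; rewrite !mxE /=.
by case: i => [[|[|[|[|i]]]] ?]; rewrite //=; ring.
Qed.

Lemma nw_form_sym (x y : H4) : nw_form x y = nw_form y x.
Proof. by rewrite /nw_form; ring. Qed.

Lemma nw_decomp (x : H4) :
  x = x 0 nw_ia *: nw_a K + x 0 nw_ib *: nw_b K + x 0 nw_ic *: nw_c K
      + x 0 nw_id *: nw_d K.
Proof.
apply/rowP => i; rewrite !mxE /=.
case: i => [[|[|[|[|i]]]] Hi]; rewrite //= ?mulr1 ?mulr0 ?addr0 ?add0r;
  by congr (x _ _); apply: val_inj.
Qed.

(** Nondegeneracy: pairing with the basis vectors reads off the coordinates of [x]. *)
Lemma nw_form_inj (x : H4) : (forall y, nw_form y x = 0) -> x = 0.
Proof.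
move=> x0; rewrite (nw_decomp x).
have := x0 (nw_a K); have := x0 (nw_b K); have := x0 (nw_c K);
  have := x0 (nw_d K).
rewrite /nw_form !mxE /= !(mul0r, mul1r, addr0, add0r) => -> -> -> ->.
by rewrite !scale0r !addr0.
Qed.

Variable ell : K.
Local Notation V := (VH4 ell).
Local Notation vac := (vac ell).

Lemma vac_neq0 : vac != 0.
Proof.
apply: affine_vac_neq0.
- exact: nw_br_linl.
- exact: nw_br_linr.
- exact: nw_form_linl.
- exact: nw_form_linr.
- exact: nw_br_sym.
- exact: nw_br_leibniz.
- exact: nw_form_sym.
- exact: nw_form_inv.
Qed.

Lemma mode_linear h n : linear (mode h n : V -> V).
Proof. exact: ind_act_is_linear. Qed.

Lemma mode_linearl n (v : V) : linear (fun h => mode h n v).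
Proof.
move=> c x y; rewrite /mode affine_t_linear.
exact: (@ind_act_linearl _ _ _ _ _ v).
Qed.

(** True on the vacuum by construction, and inherited by the module it generates since k is
    central. *)
Lemma act_k (v : V) : ind_act (affine_k H4 : H4hat K) v = ell *: v.
Proof.
move: v; apply: ind_mod_ind.
- split=> [|c u v Eu Ev];
  first by rewrite scaler0 (linear_eq0 (@ind_act_is_linear _ _ _ _ _ _)).
  by rewrite ind_act_is_linear Eu Ev scalerDr !scalerA mulrC.
- rewrite (@ind_act_vac _ _ _ _ (affine_char ell)); last by move=> n _;
  rewrite mcoeff0.
  by rewrite /affine_char mulr1.
- move=> x v Ev; apply/eqP; rewrite -subr_eq0.
  rewrite -(linear_eq0 (@ind_act_linearl _ _ _ _ _ v)).
  rewrite -(affine_br_kl (@nw_br K) (@nw_form K) x).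
  rewrite ind_act_br Ev.
  have := @ind_act_is_linear _ _ _ _ _ x ell v 0.
  by rewrite (linear_eq0 (@ind_act_is_linear _ _ _ _ _ x)) !addr0 => ->.
Qed.

Lemma mode_comm h m h' n (v : V) :
  mode h m (mode h' n v) = mode h' n (mode h m v) + mode (nw_br h h') (m + n) v
    + (m%:~R * nw_form h h' * (m + n == 0)%:R * ell) *: v.
Proof.
have := ind_act_br (affine_t h m : H4hat K) (affine_t h' n) v.
rewrite [H4hat_br _ _](affine_br_t nw_br_linl nw_br_linr nw_form_linl nw_form_linr).
rewrite ind_act_linearl act_k scalerA => E.
by rewrite -addrA [mode _ (m + n) v + _]addrC E addrC subrK.
Qed.

Lemma mode_vac h n : 0 <= n -> mode h n vac = 0.
Proof.
move=> n0; rewrite /mode (@ind_act_vac _ _ _ _ (affine_char ell)).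
  by rewrite /affine_char mulr0 scale0r.
move=> k k0; rewrite mcoeffU; case: eqP => // nk.
by move: n0; rewrite nk leNgt k0.
Qed.

Lemma VH4_ind (W : set V) :
  subspace W -> W vac -> (forall h n v, W v -> W (mode h n v)) -> forall v, W v.
Proof.
move=> Wsub Wvac Wmode; apply: ind_mod_ind => // x v Wv; have [W0 Wlin] := Wsub.
rewrite (affine_decomp x) ind_act_linearl act_k scalerA; apply: (Wlin) => //.
have -> : ind_act (\sum_(n <- msupp x.1) affine_t x.1@_n n : H4hat K) v
  = \sum_(n <- msupp x.1) mode x.1@_n n v.
  elim/big_rec2: _ => [|n y1 y2 _ <-].
    by rewrite (linear_eq0 (@ind_act_linearl _ _ _ _ _ v)).
  have := @ind_act_linearl _ _ _ _ _ v 1 (affine_t x.1@_n n : H4hat K) y2.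
  by rewrite !scale1r.
apply: (big_ind W) => [//|u w Wu Ww|n _]; last exact: Wmode.
by rewrite -[u]scale1r; apply: Wlin.
Qed.

End NappiWittenModule.

(** * Subspaces and linear spans *)

Section Spans.
Variables (K : fieldType) (V : lmodType K).

Lemma lspan_subspace (S : set V) : subspace (lspan S).
Proof.
split=> [|c u v [s sS ->] [t tS ->]]; first by exists [::]; rewrite ?big_nil.
exists ([seq (c * p.1, p.2) | p <- s] ++ t) => [p|].
  by rewrite mem_cat => /orP[/mapP[q /sS Sq ->]|/tS].
rewrite big_cat big_map scaler_sumr; congr (_ + _).
by apply: eq_bigr => p _; rewrite scalerA.
Qed.

Lemma subspace_sum (W : set V) (I : Type) (r : seq I) (P : pred I)
    (f : I -> V) :
  subspace W -> (forall i, P i -> W (f i)) -> W (\sum_(i <- r | P i) f i).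
Proof.
move=> [W0 Wlin] Wf; apply: (big_ind W) => // u v Wu Wv.
by rewrite -[u]scale1r; apply: Wlin.
Qed.

Lemma subspaceZ (W : set V) c v : subspace W -> W v -> W (c *: v).
Proof. by move=> [W0 Wlin] Wv; rewrite -[_ *: _]addr0; apply: Wlin. Qed.

Lemma subspaceD (W : set V) u v : subspace W -> W u -> W v -> W (u + v).
Proof. by move=> [W0 Wlin] Wu Wv; rewrite -[u]scale1r; apply: Wlin. Qed.

Lemma lspan_gen (S : set V) v : S v -> lspan S v.
Proof.
move=> Sv; exists [:: (1, v)] => [p|]; first by rewrite inE => /eqP ->.
by rewrite big_seq1 scale1r.
Qed.

Lemma lspan_min (S W : set V) : subspace W -> S `<=` W -> lspan S `<=` W.
Proof.
move=> Wsub SW _ [s sS ->]; rewrite big_seq; apply: subspace_sum => // p /sS Sp.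
by apply: subspaceZ => //; apply: SW.
Qed.

Lemma linear_preim (U : lmodType K) (f : U -> V) (W : set V) :
  linear f -> subspace W -> subspace [set u | W (f u)].
Proof.
move=> fl [W0 Wlin]; split=> [|c u v Wu Wv];
  first by rewrite /= (linear_eq0 fl).
by rewrite /= fl; apply: Wlin.
Qed.

End Spans.

(** * The grading by weight: stability under modes, exhaustion, degree one, finite dimension *)

Section Grading.
Variables (K : fieldType) (ell : K).
Local Notation H4 := (H4 K).
Local Notation V := (VH4 ell).
Local Notation vac := (vac ell).
Local Notation grade := (@VH4_grade K ell).
Local Notation weight s := (\sum_(p <- s) p.2)%N.

Lemma VH4_grade_subspace n : subspace (grade n).
Proof. exact: lspan_subspace. Qed.
Hint Resolve VH4_grade_subspace : core.

Lemma VH4_grade0 n : grade n 0.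
Proof. by case: (VH4_grade_subspace n). Qed.

Lemma monomial_grade (s : seq (H4 * nat)) :
  all (fun p => 0 < p.2)%N s -> grade (weight s)%:Z (monomial ell s).
Proof. by move=> s0; apply: lspan_gen; exists s. Qed.

Lemma VH4_grade_ind (W : set V) (n : int) :
  subspace W ->
  (forall s : seq (H4 * nat), all (fun p => 0 < p.2)%N s -> (weight s)%:Z = n ->
     W (monomial ell s)) ->
  forall v, grade n v -> W v.
Proof. by move=> Wsub Wm; apply: lspan_min => // _ [s [s0 sn] <-];
  apply: Wm. Qed.

Lemma mode_neg_grade h (k : nat) (n : int) v : (0 < k)%N ->
  grade n v -> grade (k%:Z + n) (mode h (- k%:Z) v).
Proof.
move=> k0; move: v; apply: VH4_grade_ind.
  exact: linear_preim (mode_linear _ _) (VH4_grade_subspace _).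
move=> s s0 <-; have := @monomial_grade ((h, k) :: s).
by rewrite big_cons /= k0 PoszD; apply.
Qed.

(** A nonnegative mode is commuted to the right through a monomial until it kills the vacuum, each
    commutator having the right weight. *)
Lemma mode_grade h (m n : int) v : grade n v -> grade (n - m) (mode h m v).
Proof.
move: v; apply: VH4_grade_ind.
  exact: linear_preim (mode_linear _ _) (VH4_grade_subspace _).
move=> s s0 <- {n}.
(* A negative mode merely lengthens the monomial. *)
have neg t (k : nat) : all (fun p => 0 < p.2)%N t -> m = - k.+1%:Z ->
    grade ((weight t)%:Z - m) (mode h m (monomial ell t)).
  move=> t0 ->; rewrite opprK addrC; apply: mode_neg_grade => //.
  exact: monomial_grade.
elim: s h m s0 neg => [|[h' k] s IH] h m s0 neg.
  case: m neg => [m|m] neg; last by apply: neg; rewrite // NegzE.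
  by rewrite mode_vac //; exact: VH4_grade0.
case: m neg => [m|m] neg; last by apply: neg; rewrite // NegzE.
have /andP[k0 s0'] := s0.
have IH' h1 m1 : grade ((weight s)%:Z - m1) (mode h1 m1 (monomial ell s)).
  apply: IH => // t j t0 ->; rewrite opprK addrC; apply: mode_neg_grade => //.
  exact: monomial_grade.
rewrite big_cons /= mode_comm PoszD; apply: subspaceD => //.
  apply: subspaceD => //.
    by rewrite -addrA; apply: mode_neg_grade => //.
  have -> : k%:Z + (weight s)%:Z - m%:Z = (weight s)%:Z - (m%:Z - k%:Z) by ring.
  exact: IH'.
(* The central term occurs only for m = k, when the target degree is the weight of [s]. *)
case: eqP => [/eqP|_]; last first.
  by rewrite mulr0 mul0r scale0r; exact: VH4_grade0.
rewrite subr_eq0 => /eqP [mk]; apply: subspaceZ => //.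
have -> : k%:Z + (weight s)%:Z - m%:Z = (weight s)%:Z by rewrite mk; ring.
exact: monomial_grade.
Qed.

Lemma VH4_grade_neg (n : int) v : n < 0 -> grade n v -> v = 0.
Proof.
move=> n0; apply: (@VH4_grade_ind [set 0]).
  by split=> // c u w -> ->; rewrite scaler0 addr0.
by move=> s _ sn; move: n0; rewrite -sn.
Qed.

Lemma vac_grade : grade 0 vac.
Proof. by have := @monomial_grade [::] isT; rewrite big_nil. Qed.

Lemma VH4_grade_sum (v : V) : exists N : nat, exists2 f : nat -> V,
  (forall n : nat, grade n%:Z (f n)) & v = \sum_(n < N) f n.
Proof.
(* Requiring [f] to vanish from [N] on allows two decompositions to be extended to a common length
   and added. *)
pose W : set V := [set v | exists N : nat, exists f : nat -> V,
  [/\ forall n : nat, grade n%:Z (f n), forall n : nat, (N <= n)%N -> f n = 0 &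
      v = \sum_(n < N) f n]].
have Wg n u : grade n u -> W u.
  case: n => [n|n] gu; last first.
    rewrite (VH4_grade_neg _ gu) //; exists 0%N, (fun=> 0).
    by split=> [k|//|]; [exact: VH4_grade0|rewrite big_ord0].
  exists n.+1, (fun k => if k == n then u else 0); split=> [k|k kn|].
  - by case: eqP => [->|_] //; exact: VH4_grade0.
  - by rewrite gtn_eqF.
  - by rewrite (bigD1 ord_max) //= eqxx big1 ?addr0 // => i;
    rewrite -val_eqE /= => /negbTE ->.
have Wsub : subspace W.
  split=> [|c u w [N [f [fg f0 ->]]] [M [g [gg gM0 ->]]]];
    first exact: Wg (VH4_grade0 0).
  exists (maxn N M), (fun n => c *: f n + g n); split=> [n|n|].
  - by case: (VH4_grade_subspace n) => _; apply.
  - by rewrite geq_max => /andP[/f0 -> /gM0 ->]; rewrite scaler0 addr0.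
  have ext k (e : nat -> V) : (forall n, (k <= n)%N -> e n = 0) -> forall m,
      (k <= m)%N -> \sum_(n < k) e n = \sum_(n < m) e n.
    move=> e0 m km; rewrite (big_ord_widen _ _ km) big_mkcond; apply: eq_bigr.
    by move=> i _; case: ltnP => // /e0 ->.
  rewrite (ext _ _ f0 _ (leq_maxl N M)) (ext _ _ gM0 _ (leq_maxr N M)).
  by rewrite scaler_sumr -big_split.
suff [N [f [fg _ ->]]] : W v by exists N, f.
move: v; apply: VH4_ind => //; first exact: Wg vac_grade.
move=> h n _ [N [f [fg _ ->]]].
have -> : mode h n (\sum_(k < N) f k) = \sum_(k < N) mode h n (f k).
  elim/big_rec2: _ => [|k y1 y2 _ <-];
    first exact: linear_eq0 (mode_linear h n).
  by have := mode_linear h n 1 (f k) y2; rewrite !scale1r.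
by apply: subspace_sum => // k _; apply: Wg (mode_grade _ _ (fg k)).
Qed.

(** Applying y(1) to x(-1)1 gives [ell] times the form of [y] and [x] times the vacuum; the vacuum
    and [ell] are nonzero and the form is nondegenerate. *)
Lemma mode_eq0 (x : H4) : ell != 0 -> mode x (-1) vac = 0 -> x = 0.
Proof.
move=> ell0 x0; apply: nw_form_inj => y.
have := mode_comm y 1 x (-1) vac.
rewrite x0 (linear_eq0 (mode_linear _ _)) mode_vac // mode_vac //.
rewrite (linear_eq0 (mode_linear _ _)).
rewrite !add0r subrr eqxx mul1r mulr1 => /esym/eqP.
by rewrite scaler_eq0 (negPf (vac_neq0 ell)) orbF mulf_eq0 (negPf ell0) orbF => /eqP.
Qed.

Lemma mode_inj : ell != 0 -> injective (fun h : H4 => mode h (-1) vac).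
Proof.
move=> ell0 x y /= xy; apply/eqP; rewrite -subr_eq0; apply/eqP/mode_eq0 => //.
have := @mode_linearl K ell (-1) vac (-1) y x.
by rewrite xy !scaleN1r addNr [- y + x]addrC.
Qed.

Lemma range_mode : range (fun h : H4 => mode h (-1) vac) = grade 1.
Proof.
rewrite predeqE => v; split=> [[h _ <-]|].
  by have := @monomial_grade [:: (h, 1%N)] isT; rewrite big_seq1.
move: v; apply: VH4_grade_ind.
  have L := @mode_linearl K ell (-1) vac.
  split=> [|c _ _ [x _ <-] [y _ <-]]; first by exists 0 => //;
    exact: linear_eq0 L.
  by exists (c *: x + y) => //; exact: L.
case=> [|[h k] [|[h' k'] s]]; rewrite ?big_cons ?big_nil //=.
  by rewrite andbT addn0 => _ [->]; exists h.
by move=> /and3P[k0 k'0 _] [ks]; exfalso; move: k0 k'0 ks; clear; lia.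
Qed.

Lemma VH4_finite_dim n : finite_dim (grade n).
Proof.
case: n => [n|n]; last first.
  by exists [::] => v gv; exists [::]; rewrite // big_nil (VH4_grade_neg _ gv).
pose basis := [:: nw_a K; nw_b K; nw_c K; nw_d K].
pose next (n : nat) (l : seq V) :=
  l ++ [seq mode q.1 (- q.2%:Z) v |
         q <- [seq (e, m) | e <- basis, m <- iota 0 n.+2], v <- l].
(* [lst n] is made to span all monomials of weight at most [n]: a monomial of weight at most n + 1
   starts with a mode -m, where m <= n + 1, followed by one of weight at most [n]. *)
pose fix lst n := if n is n'.+1 then next n' (lst n') else [:: vac].
have span : forall (s : seq (H4 * nat)), all (fun p => 0 < p.2)%N s ->
    (weight s <= n)%N -> lspan [set` lst n] (monomial ell s).
  elim: n => [|n IH] s.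
    case: s => [|[h m] s] /=; first by move=> _ _; apply: lspan_gen;
      rewrite /= inE.
    by rewrite big_cons /= => /andP[m0 _];
      rewrite leqn0 addn_eq0 => /andP[/eqP m00]; move: m0; rewrite m00.
  have up : lspan [set` lst n] `<=` lspan [set` lst n.+1].
    apply: lspan_min; first exact: lspan_subspace.
    by move=> v /= vl; apply: lspan_gen; rewrite /= mem_cat vl.
  case: s => [|[h m] s] /=; first by move=> _ _; apply: up; apply: (IH [::]);
    rewrite ?big_nil.
  rewrite big_cons /= => /andP[m0 s0] ms.
  have {}IH : lspan [set` lst n] (monomial ell s) by apply: IH => //; lia.
  have basisP e : e \in basis ->
      lspan [set` lst n.+1] (mode e (- m%:Z) (monomial ell s)).
    move=> eb; suff: lspan [set` lst n] `<=`
        [set v | lspan [set` lst n.+1] (mode e (- m%:Z) v)] by apply; exact: IH.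
    apply: lspan_min.
      exact: linear_preim (mode_linear _ _) (lspan_subspace _).
    move=> v /= vl; apply: lspan_gen; rewrite /= mem_cat; apply/orP; right.
    apply/allpairsP; exists ((e, m), v); split=> //.
    apply/allpairsP; exists (e, m); split=> //.
    by rewrite mem_iota add0n /= ltnS; move: ms; rewrite -ltnS; lia.
  have Wsub := linear_preim (mode_linearl (- m%:Z) (monomial ell s))
    (lspan_subspace [set` lst n.+1]).
  move: (nw_decomp h) => ->; rewrite -/([set u | lspan _ (mode u _ _)] _).
  by do !apply: subspaceD => //; apply: subspaceZ => //; apply: basisP;
    rewrite !inE eqxx ?orbT.
exists (lst n); apply: VH4_grade_ind; first exact: lspan_subspace.
by move=> s s0 [sn]; apply: span => //; rewrite sn.
Qed.

Lemma omega_grade : grade 2 (omega ell).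
Proof.
have g2 x y : grade 2 (mode x (-1) (mode y (-1) vac)).
  by have := @monomial_grade [:: (x, 1%N); (y, 1%N)] isT;
    rewrite !big_cons big_nil.
have g1 x : grade 2 (mode x (-2) vac).
  by have := @monomial_grade [:: (x, 2%N)] isT; rewrite !big_cons big_nil.
rewrite /omega -!scaleNr; do ?[apply: subspaceD|apply: subspaceZ] => //.
Qed.

End Grading.

(** * Binomial coefficients with integer upper argument *)

Section BinomialZ.
Variable K : fieldType.
Hypothesis K0 : [pchar K] =i pred0.

Lemma binz0 m : binz K m 0 = 1.
Proof. by rewrite /binz big_ord0 divr1. Qed.

Lemma binz1 m : binz K m 1 = m%:~R.
Proof. by rewrite /binz big_ord1 subr0 divr1. Qed.

Lemma binz0l i : binz K 0 i.+1 = 0.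
Proof. by rewrite /binz big_ord_recl subr0 mul0r mul0r. Qed.

Lemma natr_neq0_pchar0 n : n.+1%:R != 0 :> K.
Proof. by rewrite (pcharf0P K).1. Qed.

Lemma binzN2 i : (-1) ^+ i * binz K (-2) i = i.+1%:R.
Proof.
have E : \prod_(j < i) (-2 - j%:Z) = (-1) ^+ i * (i.+1)`!%:Z.
  elim: i => [|i IH]; first by rewrite big_ord0.
  by rewrite big_ord_recr IH /= [(i.+2)`!]factS PoszM exprS; ring.
rewrite /binz E rmorphM rmorphXn rmorphN1 mulrA mulrA -exprMn mulrNN mulr1.
rewrite expr1n mul1r /= -pmulrn factS natrM mulfK //.
by case: i`! (fact_gt0 i) {E} => // n _; exact: natr_neq0_pchar0.
Qed.

End BinomialZ.

(** * Consequences of the Jacobi identity in any vertex algebra *)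

Section VertexAlgebraTheory.
Variables (K : fieldType) (V : lmodType K) (one : V) (Y : V -> int -> V -> V).
Hypothesis Y_va : is_vertex_algebra one Y.

Lemma va0l n v : Y 0 n v = 0.
Proof. exact: (linear_eq0 (va_linearl Y_va n v)). Qed.

Lemma va0r u n : Y u n 0 = 0.
Proof. exact: (linear_eq0 (va_linearr Y_va u n)). Qed.

Lemma vaZl c u n v : Y (c *: u) n v = c *: Y u n v.
Proof. by have := va_linearl Y_va n v c u 0; rewrite /= va0l !addr0. Qed.

(** At l = 0 the coefficients binom(0, i) leave only i = 0 on the left of the Jacobi identity; on
    the right the products u_i v stop at [B]. *)
Lemma va_commutator u v w (m n : int) (B : nat) :
  (forall i : nat, (B <= i)%N -> Y u i v = 0) ->
  Y u m (Y v n w) - Y v n (Y u m w)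
  = \sum_(i < B) binz K m i *: Y (Y u i v) (m + n - i%:Z) w.
Proof.
move=> uv0; have [N /(_ (maxn N B).+1)] := va_jacobi Y_va u v w 0 m n.
rewrite (leqW (leq_maxl _ _)) => /(_ isT).
rewrite big_ord_recl big1 => [|i _]; last by rewrite binz0l mulr0 scale0r.
rewrite expr0 mul1r binz0 !scale1r !subr0 !addr0 => ->.
rewrite (big_ord_widen _
  (fun i => binz K m i *: Y (Y u i%:Z v) (m + n - i%:Z) w)
  (leqW (leq_maxr N B))) [RHS]big_mkcond.
apply: eq_bigr => i _; rewrite add0r; case: ltnP => // /uv0 ->.
by rewrite va0l scaler0.
Qed.

(** The recursion for v |-> v_(-2) 1. It is the Jacobi identity on the vacuum at m = 0, n = -2:
    creation kills every term on the left but the u_(l-i) v_(i-2) 1 with i = 0, 1. *)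
Lemma va_commutator_translation u v (l : int) :
  Y (Y u l v) (-2) one = Y u l (Y v (-2) one) - l%:~R *: Y u (l - 1) v.
Proof.
have [N /(_ N.+2 (leqW (leqnSn _)))] := va_jacobi Y_va u v one l 0 (-2).
rewrite [in RHS]big_ord_recl [in RHS]big1 => [|i _]; last first.
  by rewrite binz0l scale0r.
rewrite /= binz0 scale1r !addr0 add0r => <-.
rewrite 2!big_ord_recl big1 => [|i _]; last first.
  rewrite (va_creation0 Y_va u) // va0r scaler0 subr0.
  by rewrite (va_creation0 Y_va v) ?va0r ?scaler0.
rewrite (va_creation0 Y_va u) // (va_creation0 Y_va u) // !va0r !scaler0 !subr0.
rewrite /= binz0 binz1 expr0 expr1 mul1r scale1r mulN1r scaleNr addr0.
by rewrite (va_creation Y_va).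
Qed.

(** The Jacobi identity for [u] and the vacuum at l = -2, m = 0. As 1_j is nonzero only for j = -1,
    one term survives for n <> 0, at i = |n| - 1, with coefficient i + 1 by [binzN2]; its sign
    depends on which of the two products it comes from. *)
Lemma va_derivative (K0 : [pchar K] =i pred0) u (n : int) w :
  Y (Y u (-2) one) n w = - n%:~R *: Y u (n - 1) w.
Proof.
have [N /(_ (N + `|n|).+1%N)] := va_jacobi Y_va u one w (-2) 0 n.
rewrite (leqW (leq_addr _ _)) => /(_ isT).
rewrite [in RHS]big_ord_recl [in RHS]big1 => [|i _]; last first.
  by rewrite binz0l scale0r.
rewrite /= binz0 scale1r !addr0 !add0r => <-.
have -> : (-1) ^ (-2) = 1 :> K by rewrite -exprnN expr2 mulrNN mulr1 invr1.
case: n => [[|k]|k].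
- rewrite oppr0 scale0r big1 // => i _; rewrite !(va_vacuum Y_va).
  by rewrite !ifF ?va0r ?scaler0 ?subr0 ?scaler0 //; lia.
- have kM : (k < (N + `|k.+1|).+1)%N by rewrite /= ltnS (leq_trans (leqnSn k)) ?leq_addl.
  rewrite (bigD1 (Ordinal kM)) //= big1 => [|i].
    have e1 : (k.+1%:Z + k%:Z == -1) = false by lia.
    have e2 : (k.+1%:Z - 2 - k%:Z == -1) by lia.
    rewrite binzN2 // !(va_vacuum Y_va) e1 e2.
    rewrite va0r sub0r scale1r scalerN addr0 scaleNr -pmulrn.
    by have -> : k.+1%:Z - 1 = k%:Z by lia.
  rewrite -val_eqE /= => ik;
    rewrite !(va_vacuum Y_va) !ifF ?va0r ?scaler0 ?subr0 ?scaler0 //; lia.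
- have kM : (k < (N + `|Negz k|).+1)%N by rewrite /= ltnS (leq_trans (leqnSn k)) ?leq_addl.
  rewrite (bigD1 (Ordinal kM)) //= big1 => [|i].
    have e1 : (Negz k + k%:Z == -1) by lia.
    have e2 : (Negz k - 2 - k%:Z == -1) = false by lia.
    rewrite binzN2 // !(va_vacuum Y_va) e1 e2.
    rewrite scaler0 subr0 addr0 NegzE mulrNz opprK -pmulrn.
    by have -> : - k.+1%:Z - 1 = -2 - k%:Z by lia.
  rewrite -val_eqE /= => ik;
    rewrite !(va_vacuum Y_va) !ifF ?va0r ?scaler0 ?subr0 ?scaler0 //; lia.
Qed.

End VertexAlgebraTheory.

(** * The conformal vector, the Virasoro relations and the L(0)-grading *)

Section ConformalVector.
Variables (K : fieldType) (ell : K).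
Hypothesis K0 : [pchar K] =i pred0.
Hypothesis ell0 : ell != 0.
Local Notation H4 := (H4 K).
Local Notation V := (VH4 ell).
Local Notation vac := (vac ell).
Local Notation omega := (omega ell).
Local Notation a := (nw_a K).
Local Notation b := (nw_b K).
Local Notation c := (nw_c K).
Local Notation d := (nw_d K).

Let two0 : 2%:R != 0 :> K. Proof. exact: natr_neq0_pchar0. Qed.

Lemma modeD h n (u v : V) : mode h n (u + v) = mode h n u + mode h n v.
Proof. by have := mode_linear h n 1 u v; rewrite !scale1r. Qed.

Lemma mode0 h n : mode h n (0 : V) = 0.
Proof. exact: linear_eq0 (mode_linear h n). Qed.

Lemma modeZ h n k (v : V) : mode h n (k *: v) = k *: mode h n v.
Proof. by have := mode_linear h n k v 0; rewrite !addr0 mode0 addr0. Qed.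

Lemma modeN h n (v : V) : mode h n (- v) = - mode h n v.
Proof. by rewrite -scaleN1r modeZ scaleN1r. Qed.

Lemma mode0l n (v : V) : mode 0 n v = 0.
Proof. exact: linear_eq0 (mode_linearl n v). Qed.

Lemma modeNl h n (v : V) : mode (- h) n v = - mode h n v.
Proof.
by have := mode_linearl n v (-1) h 0; rewrite mode0l !addr0 !scaleN1r.
Qed.

Lemma mode_mode1_vac h x (i : nat) :
  mode h i (mode x (-1) vac) = mode (nw_br h x) (i%:Z - 1) vac
    + ((i == 1%N)%:R * nw_form h x * ell) *: vac.
Proof.
rewrite mode_comm (mode_vac _ h) // mode0 add0r; congr (_ + _ *: _).
by rewrite subr_eq0; case: i => [|[|i]] /=; ring.
Qed.

Lemma mode_mode2_vac h x y (i : nat) :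
  mode h i (mode x (-1) (mode y (-1) vac)) =
  match i with
  | 0 => mode x (-1) (mode (nw_br h y) (-1) vac)
         + mode (nw_br h x) (-1) (mode y (-1) vac)
  | 1 => (nw_form h y * ell) *: mode x (-1) vac
         + mode (nw_br (nw_br h x) y) (-1) vac
         + (nw_form h x * ell) *: mode y (-1) vac
  | 2 => (nw_form (nw_br h x) y * ell) *: vac
  | _ => 0
  end.
Proof.
rewrite mode_comm mode_mode1_vac; case: i => [|[|i]].
- by rewrite !mul0r !scale0r !addr0.
- rewrite /= mode_vac // add0r modeZ !mul1r.
  by rewrite (mode_mode1_vac _ _ 0) /= !mul0r scale0r addr0 mulr1.
have -> : i.+2%:Z - 1 = i.+1%:Z by lia.
have -> : (i.+1%:Z == 0) = false by [].
rewrite /= mode_vac // mulr0 !mul0r !scale0r !addr0 mode0 add0r.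
rewrite mode_mode1_vac; case: i => [|i]; last first.
  by rewrite mode_vac ?mul0r ?scale0r ?addr0 //; lia.
by rewrite mode_vac // add0r mul1r.
Qed.

Lemma nw_br_c (h : H4) : nw_br h c = 0.
Proof. by rewrite nw_br_sym; have [_ _ _ ->] := nw_br_table K;
  rewrite oppr0. Qed.

Lemma mode_c2_vac h (i : nat) :
  mode h i (mode c (-2) vac)
  = (if i == 2%N then 2%:R * nw_form h c * ell else 0) *: vac.
Proof.
rewrite mode_comm mode_vac // mode0 nw_br_c mode0l !add0r; congr (_ *: _).
by case: i => [|[|[|i]]] /=; ring.
Qed.

Lemma nw_decomp_ind (W : set H4) :
  subspace W -> W a -> W b -> W c -> W d -> forall h, W h.
Proof.
move=> Wsub Wa Wb Wc Wd h; rewrite (nw_decomp h).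
by do !apply: subspaceD => //; apply: subspaceZ.
Qed.

(** Checked on the basis. Only h = d sees the two correction terms of [omega]: a(-1)b(-1)1
    contributes an extra c(-1)1 at i = 1, removed by c(-1)c(-1)1, and a multiple of 1 at i = 2,
    removed by c(-2)1. *)
Lemma mode_omega h (i : nat) :
  mode h i omega = if i == 1%N then mode h (-1) vac else 0.
Proof.
have [brab brda brdb brc] := nw_br_table K.
have brba : nw_br b a = - c by rewrite nw_br_sym brab.
have brad : nw_br a d = - a by rewrite nw_br_sym brda.
have brbd : nw_br b d = b by rewrite nw_br_sym brdb opprK.
have [fab fcd fsym [faa fbb fcc fdd [fac fad fbc fbd]]] := nw_form_table K.
have fba := etrans (fsym b a) fab; have fdc := etrans (fsym d c) fcd.
have fca := etrans (fsym c a) fac; have fda := etrans (fsym d a) fad.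
have fcb := etrans (fsym c b) fbc; have fdb := etrans (fsym d b) fbd.
have fE := (fab, fcd, faa, fbb, fcc, fdd, fac, fad, fbc, fbd, fba, fdc, fca, fda, fcb, fdb).
have bE := (brab, brda, brdb, brc, @nw_br_c, brba, brad, brbd, @nw_br_anti K).
have fl0 x : nw_form 0 x = 0 :> K by rewrite /nw_form !mxE; ring.
have flN x y : nw_form (- x) y = - nw_form x y :> K by rewrite /nw_form !mxE;
  ring.
have br0 x : nw_br 0 x = 0 :> H4 := linear_eq0 (nw_br_linl x).
have brN x y : nw_br (- x) y = - nw_br x y :> H4.
  by have := nw_br_linl y (-1) x 0; rewrite /= br0 !addr0 !scaleN1r.
have comm x y : nw_br x y = 0 ->
    mode x (-1) (mode y (-1) vac) = mode y (-1) (mode x (-1) vac).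
  by move=> xy; rewrite mode_comm xy mode0l -[_ == 0]/false mulr0 mul0r scale0r !addr0.
move: h; apply: nw_decomp_ind.
  split=> [|k x y /= Ex Ey]; first by rewrite /= !mode0l; case: ifP.
  by rewrite !mode_linearl Ex Ey; case: ifP; rewrite ?scaler0 ?addr0.
all: rewrite /omega !(modeD, modeN, modeZ) !mode_mode2_vac mode_c2_vac.
all: case: i => [|[|[|i]]] /=;
  rewrite ?bE ?fE ?(fl0, flN, br0, brN, mode0l, mode0, modeNl, modeN).
all: rewrite ?(mul0r, mulr0, mul1r, mulr1, scale0r, scaler0, add0r, addr0, subr0, oppr0) //.
(* The remaining goals run through h = a, b, c, d, each with increasing [i]. *)
- by rewrite (comm a c) ?nw_br_c // subrr scaler0.
- by rewrite scalerA mulVf // scale1r.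
- by rewrite addNr scaler0.
- by rewrite brc mode0l oppr0 add0r scalerA mulVf // scale1r.
- by rewrite fcb oppr0 mul0r scale0r scaler0.
- by rewrite scalerA mulVf // scale1r.
- by rewrite addNr scaler0.
(* Here h = d and i = 1: the two multiples of c(-1)1 cancel and d(-1)1 remains. *)
- rewrite -mulr2n -scaler_nat scalerDr !scalerA mulVf // scale1r.
  have -> : (2%:R * ell ^+ 2)^-1 * (2%:R * ell) = ell^-1.
    by field; rewrite ell0 two0.
  by rewrite addrAC subrr add0r.
- by rewrite !scalerA !mulVf ?mulf_neq0 // subrr.
Qed.

Variable Y : V -> int -> V -> V.
Hypothesis Y_va : is_vertex_algebra vac Y.
Hypothesis Y_gen : forall (h : H4) (n : int) (v : V), Y (mode h (-1) vac) n v = mode h n v.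
Local Notation L := (Lmode Y omega).

Lemma LmodeD m (u v : V) : L m (u + v) = L m u + L m v.
Proof. by have := va_linearr Y_va omega (m + 1) 1 u v; rewrite !scale1r. Qed.

Lemma LmodeZ m k (v : V) : L m (k *: v) = k *: L m v.
Proof.
by have := va_linearr Y_va omega (m + 1) k v 0;
  rewrite !addr0 (va0r Y_va) addr0.
Qed.

(** In the commutator formula for h(-1)1 and [omega], [mode_omega] leaves the term i = 1 with
    coefficient n; the shift in L(m) = omega_(m+1) cancels the -1 of that term. *)
Lemma mode_Lmode h (m n : int) (v : V) :
  mode h n (L m v) - L m (mode h n v) = n%:~R *: mode h (m + n) v.
Proof.
rewrite -(Y_gen h n (L m v)) -(Y_gen h n v).
rewrite (@va_commutator _ _ _ _ Y_va _ _ _ _ _ 2) => [|i i2]; last first.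
  by rewrite Y_gen mode_omega; case: i i2 => [|[|i]].
rewrite !big_ord_recl big_ord0 /= !Y_gen !mode_omega /= (va0l Y_va) scaler0.
rewrite add0r addr0 binz1 Y_gen; congr (_ *: mode h _ v); rewrite /bump /=;
  ring.
Qed.

Lemma Lmode_mode h (m n : int) (v : V) :
  L m (mode h n v) = mode h n (L m v) - n%:~R *: mode h (m + n) v.
Proof. by rewrite -mode_Lmode opprB addrC subrK. Qed.

Lemma Lmode_vac (m : int) : -1 <= m -> L m vac = 0.
Proof. by move=> m1; rewrite /Lmode (va_creation0 Y_va) //; lia. Qed.

Lemma Lmode0_grade (n : int) (v : V) : VH4_grade n v -> L 0 v = n%:~R *: v.
Proof.
move: v; apply: VH4_grade_ind.
  split=> [|k u v /= Eu Ev]; first by rewrite scaler0; exact: va0r Y_va _ _.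
  by rewrite LmodeD LmodeZ Eu Ev scalerDr !scalerA mulrC.
move=> s _ <- {n}; elim: s => [|[h k] s IH].
  by rewrite big_nil scale0r Lmode_vac.
rewrite big_cons /= Lmode_mode IH add0r modeZ mulrNz scaleNr opprK -scalerDl.
by rewrite PoszD rmorphD addrC.
Qed.

(** At L(1) the bracket [a,b] = c is offset by the term in c(-2)1. At L(2) the pairs (a,b) and (c,d)
    each contribute [ell], whence 2, half the central charge. *)
Lemma Lmode_omega (m : nat) :
  L m omega = match m with 0 => 2%:R *: omega | 2 => 2%:R *: vac | _ => 0 end.
Proof.
case: m => [|m]; first by rewrite (Lmode0_grade (omega_grade ell)).
have [brab brda brdb brc] := nw_br_table K.
have [fab fcd fsym [faa fbb fcc fdd [fac fad fbc fbd]]] := nw_form_table K.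
have LN (v : V) : L m.+1 (- v) = - L m.+1 v.
  by have := LmodeZ m.+1 (-1) v; rewrite !scaleN1r.
have L1 x (i : nat) : L m.+1 (mode x (- i.+1%:Z) vac) = i.+1%:R *: mode x (m%:Z - i%:Z) vac.
  rewrite Lmode_mode Lmode_vac // mode0 sub0r mulrNz scaleNr opprK -pmulrn.
  by congr (_ *: mode x _ vac); lia.
have L2 x y : L m.+1 (mode x (-1) (mode y (-1) vac)) = mode x m (mode y (-1) vac).
  rewrite Lmode_mode (L1 y 0%N) scale1r subr0 mode_vac // mode0 sub0r.
  by rewrite mulrNz scaleNr opprK scale1r; congr (mode x _ _); lia.
rewrite /Defs.omega !(LmodeD, LN, LmodeZ) !L2 (L1 _ 1%N) !mode_mode1_vac.
rewrite brab !nw_br_c mode0l add0r fab fcd fcc.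
have -> : nw_br c d = 0 by rewrite brc.
rewrite mode0l add0r !mulr0 !mul0r scale0r scaler0 subr0 mulr1.
case: m {LN L1 L2} => [|[|m]] /=.
- rewrite !mul0r !scale0r !addr0 scalerA; apply/eqP; rewrite subr_eq0;
  apply/eqP.
  by congr (_ *: _); field; rewrite ell0 two0.
- rewrite !mode_vac // !scaler0 add0r subr0 mul1r -scalerDl scalerA.
  by congr (_ *: _); field.
- by rewrite !mode_vac ?scaler0 ?mul0r ?scale0r ?addr0 ?subr0 ?scaler0 //; lia.
Qed.

Lemma Lmode_translation (v : V) : L (-1) v = Y v (-2) vac.
Proof.
move: v; apply: VH4_ind.
- split=> [|k u v /= Eu Ev].
    by rewrite (va0l Y_va); exact: va0r Y_va _ _.
  by rewrite LmodeD LmodeZ Eu Ev (va_linearl Y_va).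
- by rewrite Lmode_vac // (va_vacuum Y_va).
- move=> h n v Ev; rewrite Lmode_mode Ev -(Y_gen h n v).
  by rewrite (va_commutator_translation Y_va) !Y_gen [-1 + n]addrC.
Qed.

Lemma Lmode_derivative (u v : V) (n : int) :
  Y (L (-1) u) n v = - n%:~R *: Y u (n - 1) v.
Proof. by rewrite Lmode_translation (va_derivative Y_va). Qed.

(** Since omega_i omega = L(i-1) omega, the commutator formula stops at i = 3. Its terms are
    -(m+n+2) L(m+n) from L(-1) omega, 2(m+1) L(m+n) from L(0) omega, and 2 binom(m+1, 3) times a
    mode of the vacuum, nonzero only for m + n = 0. *)
Lemma virasoro (m n : int) (v : V) :
  L m (L n v) - L n (L m v)
  = (m - n)%:~R *: L (m + n) v
    + (if m + n == 0 then (m ^+ 3 - m)%:~R / 12%:R * 4%:R else 0) *: v.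
Proof.
have YL (i : nat) : Y omega i.+1 omega = L i omega.
  by rewrite /Lmode; congr (Y _ _ _); lia.
rewrite (@va_commutator _ _ _ _ Y_va _ _ _ _ _ 4) => [|[|i]] // => [|i3];
  last first.
  by rewrite YL Lmode_omega; case: i i3 => [|[|[|i]]].
rewrite !big_ord_recl big_ord0 /= !YL !Lmode_omega (va0l Y_va).
have -> : Y omega 0%:Z omega = L (-1) omega by [].
rewrite Lmode_derivative scaler0 add0r !addr0 binz0 scale1r.
have -> : binz K (m + 1) (bump 0 0) = (m + 1)%:~R by exact: binz1.
have -> : m + 1 + (n + 1) - 1 = m + n + 1 by ring.
have -> : m + 1 + (n + 1) - (bump 0 (bump 0 (bump 0 0)))%:Z = m + n - 1.
  by rewrite /bump /=; ring.
rewrite -[bump 0 (bump 0 (bump 0 0))]/3%N /= !(vaZl Y_va) -/(L (m + n) v).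
rewrite scalerA (va_vacuum Y_va) addrA -scalerDl; congr (_ *: _ + _).
  by rewrite !(rmorphD, rmorphB, rmorphN) /=; ring.
have -> : (m + n - 1 == -1) = (m + n == 0) by lia.
case: eqP => _; last by rewrite !scaler0 scale0r.
rewrite scalerA; congr (_ *: _).
have -> : binz K (m + 1) 3 = (m ^+ 3 - m)%:~R / 6%:R.
  have -> : m ^+ 3 - m = (m + 1 - 0%:Z) * (m + 1 - 1%:Z) * (m + 1 - 2%:Z) by ring.
  by rewrite /binz 3!big_ord_recr big_ord0 /= mul1r.
have : 6%:R != 0 :> K by exact: natr_neq0_pchar0.
have : 12%:R != 0 :> K by exact: natr_neq0_pchar0.
by move=> ? ?; field; apply/andP.
Qed.

Lemma intr_eq0_pchar0 (n : int) : (n%:~R == 0 :> K) = (n == 0).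
Proof.
case: n => n; first by rewrite -pmulrn (pcharf0P K).1.
by rewrite NegzE mulrNz oppr_eq0 -pmulrn (pcharf0P K).1.
Qed.

Lemma VH4_grade_direct (s : seq int) (f : int -> V) :
  uniq s -> (forall n, VH4_grade n (f n)) -> \sum_(n <- s) f n = 0 ->
  forall n, n \in s -> f n = 0.
Proof.
elim: s f => [//|m s IH] f /= /andP[ms us] fg; rewrite big_cons => f0.
(* Applying L(0) - m removes the component of degree m and scales the others by n - m, nonzero in
   characteristic zero. *)
have sumL : \sum_(n <- s) (n - m)%:~R *: f n = 0.
  have Lsum : L 0 (\sum_(n <- s) f n) = \sum_(n <- s) n%:~R *: f n.
    elim/big_rec2: _ => [|n y1 y2 _ <-]; first exact: va0r Y_va _ _.
    by rewrite LmodeD (Lmode0_grade (fg n)).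
  under eq_bigr do rewrite rmorphB scalerBl /=.
  rewrite sumrB -Lsum -scaler_sumr.
  have := congr1 (L 0) f0; rewrite LmodeD (Lmode0_grade (fg m)).
  have -> : L 0 0 = 0 by exact: va0r Y_va _ _.
  rewrite addrC => /addr0_eq/(congr1 -%R); rewrite opprK => ->.
  move: f0; rewrite addrC => /addr0_eq/(congr1 -%R); rewrite opprK => ->.
  by rewrite scalerN subrr.
have fs n : n \in s -> f n = 0.
  move=> ns; have gg k : VH4_grade k ((k - m)%:~R *: f k).
    by apply: subspaceZ => //; exact: VH4_grade_subspace.
  have /eqP := IH _ us gg sumL n ns.
  rewrite scaler_eq0 intr_eq0_pchar0 subr_eq0 => /orP[/eqP nm|/eqP //].
  by rewrite -nm ns in ms.
move=> n; rewrite inE => /orP[/eqP ->|/fs //].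
by rewrite -[f m]addr0 -[RHS]f0; congr (_ + _); rewrite big_seq big1.
Qed.

Lemma VH4_grade_decomp (v : V) : exists s : seq int, exists f : int -> V,
  [/\ uniq s, forall n, VH4_grade n (f n) & v = \sum_(n <- s) f n].
Proof.
have [N [f fg ->]] := VH4_grade_sum v.
exists (map Posz (iota 0 N)), (fun n => if n is Posz k then f k else 0); split.
- by rewrite map_inj_uniq ?iota_uniq // => ? ? [].
- by case=> n //; exact: VH4_grade0.
- by rewrite big_map -(big_mkord xpredT f) /index_iota subn0.
Qed.

Lemma VH4_grading : is_grading (@VH4_grade K ell).
Proof.
split; [exact: VH4_grade_subspace| |exact: VH4_grade_direct].
by move=> v; have [s [f [_ fg ->]]] := VH4_grade_decomp v; exists s, f.
Qed.

(** For the converse, L(0) - n annihilates [v] and scales its components by k - n, so directness of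
    the sum kills those of degree k <> n. *)
Lemma VH4_gradeE (n : int) (v : V) : VH4_grade n v <-> L 0 v = n%:~R *: v.
Proof.
split=> [|]; first exact: Lmode0_grade.
have [s [f [us fg ->]]] := VH4_grade_decomp v => Lv.
have gg k : VH4_grade k ((k - n)%:~R *: f k).
  by apply: subspaceZ => //; exact: VH4_grade_subspace.
have sum0 : \sum_(k <- s) (k - n)%:~R *: f k = 0.
  under eq_bigr do rewrite rmorphB scalerBl /=.
  rewrite sumrB -scaler_sumr -Lv.
  apply/eqP; rewrite subr_eq0; apply/eqP/esym.
  elim/big_rec2: _ {Lv us} => [|k y1 y2 _ <-]; first exact: va0r Y_va _ _.
  by rewrite LmodeD (Lmode0_grade (fg k)).
have f0 k : k \in s -> k != n -> f k = 0.
  move=> ks kn; have /eqP := VH4_grade_direct us gg sum0 ks.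
  by rewrite scaler_eq0 intr_eq0_pchar0 subr_eq0 (negPf kn) => /eqP.
rewrite big_seq; apply: subspace_sum => [|k ks];
  first exact: VH4_grade_subspace.
by have [<- //|kn] := eqVneq k n; rewrite f0 //; exact: VH4_grade0.
Qed.

(** A vertex subalgebra containing all h(-1)1 is stable under every h(n), and these generate the
    module from the vacuum. *)
Lemma VH4_generated : generates vac Y (@VH4_grade K ell 1).
Proof.
move=> W [Wsub Wvac WY] gW; rewrite predeqE => v; split=> // _.
move: v; apply: VH4_ind => // h n v Wv; rewrite -Y_gen; apply: WY => //.
by apply: gW; rewrite -range_mode; exists h.
Qed.

Lemma VH4_voa : is_vertex_operator_algebra vac Y (@VH4_grade K ell) omega 4%:R.
Proof.
split.
- exact: Y_va.
- exact: VH4_grading.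
- exact: VH4_finite_dim.
- by exists 0 => n n0 v /(VH4_grade_neg n0).
- exact: vac_grade.
- exact: omega_grade.
- exact: virasoro.
- exact: Lmode0_grade.
- exact: Lmode_derivative.
Qed.

End ConformalVector.

(** * Specialization to the complex numbers *)

Theorem theorem4p7 (R : realType) (ell : R[i]) (ell_neq0 : ell != 0)
    (Y : VH4 ell -> int -> VH4 ell -> VH4 ell)
    (Y_va : is_vertex_algebra (vac ell) Y)
    (Y_gen : forall (h : H4 R[i]) (n : int) (v : VH4 ell),
       Y (mode h (-1) (vac ell)) n v = mode h n v) :
  [/\ is_vertex_operator_algebra (vac ell) Y (@VH4_grade _ ell) (omega ell) 4%:R,
      forall (n : int) (v : VH4 ell),
        VH4_grade n v <-> Lmode Y (omega ell) 0 v = n%:~R *: v,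
      injective (fun h : H4 R[i] => mode h (-1) (vac ell))
        /\ range (fun h : H4 R[i] => mode h (-1) (vac ell)) = VH4_grade 1,
      generates (vac ell) Y (VH4_grade 1) &
      forall (h : H4 R[i]) (m n : int) (v : VH4 ell),
        mode h n (Lmode Y (omega ell) m v) - Lmode Y (omega ell) m (mode h n v)
        = n%:~R *: mode h (m + n) v].
Proof.
have K0 : [pchar R[i]] =i pred0 by exact: pchar_num.
split.
- exact: VH4_voa.
- exact: VH4_gradeE.
- by split; [exact: mode_inj|exact: range_mode].
- exact: VH4_generated.
- exact: mode_Lmode.
Qed.
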